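(* Let $\{X_{k,i}; i \geq 1, k \geq 1\}$ be an array of i.i.d. random variables, write $X_i = X_{1,i}$ for $i \geq 1$, and let $\{p_n; n \geq 1\}$ be a sequence of positive integers such that $n/p_n$ is bounded away from $0$ and $\infty$. For $n \geq 2$ and $1 \leq i \leq p_n$ let $\bar{X}_i^{(n)} = \frac{1}{n}\sum_{k=1}^n X_{k,i}$, and for $1 \leq i, j \leq p_n$ let $$\hat{\rho}_{i,j}^{(n)} = \frac{\sum_{k=1}^n (X_{k,i} - \bar{X}_i^{(n)})(X_{k,j} - \bar{X}_j^{(n)})}{\big(\sum_{k=1}^n (X_{k,i} - \bar{X}_i^{(n)})^2\big)^{1/2} \big(\sum_{k=1}^n (X_{k,j} - \bar{X}_j^{(n)})^2\big)^{1/2}}$$ (the Pearson correlation coefficient between the columns $(X_{1,i},\dots,X_{n,i})'$ and $(X_{1,j},\dots,X_{n,j})'$), and let $L_n = \max_{1 \leq i < j \leq p_n} |\hat{\rho}_{i,j}^{(n)}|$. Let $1/2 < \alpha \leq 1$. If $X_{1,1}$ is nondegenerate and $$\sum_{n=1}^{\infty} P\Big(\max_{1 \leq i < j \leq n} |X_i X_j| \geq n^\alpha\Big) < \infty,$$ then $$\lim_{n \to \infty} n^{1-\alpha} L_n = 0 \quad \text{a.s.}$$ *)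

(* Defs.v *)
From HB Require Import structures.
From mathcomp Require Import all_boot all_order all_algebra.
From mathcomp Require Import all_classical all_reals all_analysis.
Set Implicit Arguments. Unset Strict Implicit. Unset Printing Implicit Defensive.
Import Order.TTheory GRing.Theory Num.Theory.
Local Open Scope classical_set_scope.
Local Open Scope ring_scope.

Definition mutually_independent {d} {T : measurableType d} {R : realType}
  (P : probability T R) {I : eqType} (X : I -> {RV P >-> R}) : Prop :=
  forall (J : seq I), uniq J ->
  forall (B : I -> set R), (forall i, measurable (B i)) ->
  P (\bigcap_(i in [set` J]) (X i @^-1` B i)) =
  (\prod_(i <- J) P (X i @^-1` B i))%E.

Definition identically_distributed {d} {T : measurableType d} {R : realType}
  (P : probability T R) {I : Type} (X : I -> {RV P >-> R}) : Prop :=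
  forall i j (B : set R), measurable B -> P (X i @^-1` B) = P (X j @^-1` B).

Definition nondegenerate_rv {d} {T : measurableType d} {R : realType}
  (P : probability T R) (Y : {RV P >-> R}) : Prop :=
  ~ exists c : R, P [set t | Y t = c] = 1%E.

(* Column means, 0-based indices: x k i stands for X_{k+1,i+1}. *)
Definition col_mean {R : realType} (x : nat -> nat -> R) (n i : nat) : R :=
  n%:R^-1 * \sum_(k < n) x k i.

(* Pearson correlation coefficient between columns i and j of the n x p
   data matrix (x k i)_{k<n}.  (Division by 0 gives 0 in Rocq.) *)
Definition pearson {R : realType} (x : nat -> nat -> R) (n i j : nat) : R :=
  (\sum_(k < n) (x k i - col_mean x n i) * (x k j - col_mean x n j)) /
  (Num.sqrt (\sum_(k < n) (x k i - col_mean x n i) ^+ 2) *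
   Num.sqrt (\sum_(k < n) (x k j - col_mean x n j) ^+ 2)).

Definition Lmax {R : realType} (x : nat -> nat -> R) (n p : nat) : R :=
  \big[Num.max/0]_(j < p) \big[Num.max/0]_(i < j) `|pearson x n i j|.

Definition max_prod_row {R : realType} (x : nat -> nat -> R) (n : nat) : R :=
  \big[Num.max/0]_(j < n) \big[Num.max/0]_(i < j) `|x 0%N i * x 0%N j|.

(* Main.v *)
(** Write [Z = X - E X].  The numerator of the correlation of two columns is
    [sum_k Z_ki Z_kj - S_i S_j / n] with [S_i = sum_k Z_ki], so it suffices to
    bound these sums by [eps n^alpha] and [eps n^((1 + alpha)/2)] uniformly in
    the columns, and the sums [sum_k Z_ki^2] from below by a multiple of [n].

    The summability hypothesis is used twice.  First, one factor of a product
    exceeds a constant with positive probability, so that the hypothesis gives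
    [sum_n n P(|X| >= c n^alpha) < oo], hence [E X^2 < oo].  Second, the array
    [(X_ki)], [k < n], [i < K n], is covered by [O(n)] pairs of blocks, whence,
    along dyadic [n], almost surely all products [X_ki X_kj] (and all entries)
    are eventually below [delta n^alpha], for every [delta > 0].

    The sums can therefore be truncated at [delta n^alpha].  Bennett's inequality
    for the truncated sums only needs second moments, and choosing [delta] small
    enough gives tails [O(n^-4)], which absorb the union over the [O(n^2)] pairs
    of columns because [alpha > 1/2]. *)

Require Import Defs.
From HB Require Import structures.
From mathcomp Require Import all_boot all_order all_algebra.
From mathcomp Require Import all_classical all_reals all_analysis.
From mathcomp Require Import measurable_realfun.
From mathcomp Require Import ring lra zify.
Import Order.TTheory GRing.Theory Num.Theory.
Local Open Scope classical_set_scope.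
Local Open Scope ring_scope.

Set Implicit Arguments. Unset Strict Implicit. Unset Printing Implicit Defensive.

(** * Independence and product laws *)

(** Only second moments are available, and this shapes every estimate. The squares [Z_ki^2] need not
    have a variance, so their sums are bounded from below through [min(Z_ki^2, 1)], whose mean [w]
    is positive because [X] is nondegenerate. After centering, the three kinds of sums (products,
    single entries, capped squares) all have the form [sum_k f(X_ki, X_kj)] with [f] of mean zero
    and square integrable, and one tail estimate serves them, at the exponents [alpha],
    [(1 + alpha)/2] and [1], all above 1/2.

    The hypothesis controls [X_ki X_kj], whereas the truncation concerns [Z_ki Z_kj = X_ki X_kj - m
    X_ki - m X_kj + m^2] with [m = E X]; this is why single entries must be bounded as well.

    The constant [delta] is dictated by the exponential inequality, while the hypothesis has the
    constant 1 in front of [n^alpha]. The gap is closed by comparing [n] with a dyadic scale smaller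
    by a fixed factor, at the price of a fixed number of blocks per row. *)

Definition mfun_of d1 d2 (T1 : measurableType d1) (T2 : measurableType d2)
    (f : T1 -> T2) (mf : measurable_fun setT f) : {mfun T1 >-> T2} :=
  HB.pack f (isMeasurableFun.Build _ _ _ _ f mf).

Section product_laws.
Context d d1 d2 (T : measurableType d) (T1 : measurableType d1)
  (T2 : measurableType d2) (R : realType).
Local Open Scope ereal_scope.

(** Rectangles form a pi-system generating the product sigma-algebra, and [m1] is finite, so the
    constant sequence [setT] serves as exhaustion. *)
Lemma measure_prod_eq (m1 m2 : {measure set (T1 * T2) -> \bar R}) :
  m1 setT < +oo ->
  (forall A B, measurable A -> measurable B -> m1 (A `*` B) = m2 (A `*` B)) ->
  forall S, measurable S -> m1 S = m2 S.
Proof.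
move=> m1oo m12 S mS.
pose C : set (set (T1 * T2)) := [set A `*` B | A in measurable & B in measurable].
apply: (measure_unique C (fun=> setT)) => //.
- by rewrite measurable_prod_measurableType.
- move=> _ _ [A1 mA1 [B1 mB1 <-]] [A2 mA2 [B2 mB2 <-]].
  rewrite -setXI; exists (A1 `&` A2); first exact: measurableI.
  by exists (B1 `&` B2) => //; exact: measurableI.
- by move=> _; exists setT => //; exists setT => //; rewrite setXTT.
- by rewrite bigcup_const.
- by move=> _ [A mA [B mB <-]]; exact: m12.
Qed.

Variable P : probability T R.

Lemma measurable_preimage d' (T' : measurableType d') (U : T -> T') A :
  measurable_fun setT U -> measurable A -> measurable (U @^-1` A).
Proof. by move=> mU mA; rewrite -[X in measurable X]setTI; exact: mU. Qed.

(** Both sides are finite measures in [S], the right one being the law of [(U, V)] scaled by [P H];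
    agreement on rectangles suffices. *)
Lemma indep_pair_event (U : T -> T1) (V : T -> T2) (H : set T) :
  measurable_fun setT U -> measurable_fun setT V -> measurable H ->
  (forall A B, measurable A -> measurable B ->
     P (U @^-1` A `&` V @^-1` B `&` H) = P (U @^-1` A `&` V @^-1` B) * P H) ->
  forall S, measurable S ->
    P ((fun t => (U t, V t)) @^-1` S `&` H) =
    P ((fun t => (U t, V t)) @^-1` S) * P H.
Proof.
move=> mU mV mH UVH S mS.
have mUV : measurable_fun setT (fun t => (U t, V t)) by exact: measurable_fun_pair.
have PH : P H \is a fin_num by exact: fin_num_measure.
have PH0 : (0 <= fine (P H))%R by exact: fine_ge0.
pose m1 : {measure set (T1 * T2) -> \bar R} := pushforward (mrestr P mH) (fun t => (U t, V t)).
pose m2 : {measure set (T1 * T2) -> \bar R} :=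
  mscale (NngNum PH0) (pushforward P (fun t => (U t, V t))).
suff : m1 mUV S = m2 mUV S.
  by rewrite /m1 /m2 /= /mscale /pushforward /mrestr /= fineK// muleC.
apply: measure_prod_eq => //.
  rewrite /m1 /= /pushforward /mrestr preimage_setT setTI.
  by rewrite -ge0_fin_numE.
move=> A B mA mB; rewrite /m1 /m2 /= /mscale /pushforward /mrestr /= fineK// muleC.
exact: UVH.
Qed.


Definition indep_fun (U : T -> T1) (V : T -> T2) :=
  forall A B, measurable A -> measurable B ->
    P (U @^-1` A `&` V @^-1` B) = P (U @^-1` A) * P (V @^-1` B).

End product_laws.

Section product_expectation.
Context d (T : measurableType d) (R : realType) (P : probability T R).
Local Open Scope ereal_scope.
Implicit Types U V : T -> R.

Let law_pair_integral U V (mU : measurable_fun setT U) (mV : measurable_fun setT V)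
    (h : R * R -> \bar R) : indep_fun P U V ->
  let PU := distribution P (mfun_of mU) in
  let PV := distribution P (mfun_of mV) in
  \int[pushforward P (fun t => (U t, V t))]_z h z = \int[PU \x PV]_z h z.
Proof.
have mUV : measurable_fun setT (fun t => (U t, V t)) by exact: measurable_fun_pair.
pose m1 : {measure set (R * R) -> \bar R} := pushforward P (fun t => (U t, V t)).
move=> UV PU PV; apply: (@eq_measure_integral _ _ _ _ (PU \x PV) (m1 mUV)) => S mS _.
exact/esym/(@product_measure_unique _ _ _ _ _ PU PV (m1 mUV)).
Qed.

Lemma indep_ge0_integralM U V : measurable_fun setT U -> measurable_fun setT V ->
  indep_fun P U V -> (forall t, 0 <= U t)%R -> (forall t, 0 <= V t)%R ->
  \int[P]_t (U t * V t)%:E = \int[P]_t (U t)%:E * \int[P]_t (V t)%:E.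
Proof.
move=> mU mV UV U0 V0.
pose PU := distribution P (mfun_of mU).
pose PV := distribution P (mfun_of mV).
have mUV : measurable_fun setT (fun t => (U t, V t)) by exact: measurable_fun_pair.
(* The absolute values make [h] nonnegative on the whole plane, as Tonelli requires; along [(U, V)]
   they change nothing. *)
pose h (z : R * R) : \bar R := (`|z.1| * `|z.2|)%:E.
have mh : measurable_fun [set: R * R] h.
  apply/measurable_EFinP; apply: measurable_funM.
    exact: measurableT_comp.
  exact: measurableT_comp.
have -> : \int[P]_t (U t * V t)%:E = \int[pushforward P (fun t => (U t, V t))]_z h z.
  rewrite ge0_integral_pushforward//; last by move=> z _; rewrite lee_fin mulr_ge0.
  rewrite preimage_setT; apply: eq_integral => t _ /=.
  by rewrite /h /= !ger0_norm.
rewrite (law_pair_integral mU mV) // fubini_tonelli1//; last by move=> z; rewrite lee_fin mulr_ge0.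
rewrite /fubini_F /h /=.
under eq_integral => x _.
  under eq_integral do rewrite EFinM.
  rewrite ge0_integralZl//; last by apply/measurable_EFinP; exact: normr_measurable.
  over.
rewrite /= ge0_integralZr//; last 2 first.
- by apply/measurable_EFinP; exact: normr_measurable.
- by apply: integral_ge0.
congr (_ * _).
- rewrite ge0_integral_distribution//; last by apply/measurable_EFinP; exact: normr_measurable.
  by apply: eq_integral => t _ /=; rewrite ger0_norm.
- rewrite ge0_integral_distribution//; last by apply/measurable_EFinP; exact: normr_measurable.
  by apply: eq_integral => t _ /=; rewrite ger0_norm.
Qed.

Lemma indep_fun_comp d1 d2 d3 d4 (T1 : measurableType d1) (T2 : measurableType d2)
    (T3 : measurableType d3) (T4 : measurableType d4)
    (U : T -> T1) (V : T -> T2) (f : T1 -> T3) (g : T2 -> T4) :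
  measurable_fun setT f -> measurable_fun setT g ->
  indep_fun P U V -> indep_fun P (f \o U) (g \o V).
Proof.
move=> mf mg UV A B mA mB; by apply: (UV (f @^-1` A) (g @^-1` B)); exact: measurable_preimage.
Qed.

Lemma indep_integrableM U V : indep_fun P U V ->
  P.-integrable setT (EFin \o U) -> P.-integrable setT (EFin \o V) ->
  P.-integrable setT (fun t => (U t * V t)%:E).
Proof.
move=> UV /integrableP[/measurable_EFinP mU U1] /integrableP[/measurable_EFinP mV V1].
apply/integrableP; split; first by apply/measurable_EFinP; exact: measurable_funM.
under eq_integral do rewrite /= normrM.
rewrite (@indep_ge0_integralM (Num.norm \o U) (Num.norm \o V))//=.
- by apply: lte_mul_pinfty => //; [exact: integral_ge0| rewrite ge0_fin_numE//; exact: integral_ge0].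
- exact: measurableT_comp.
- exact: measurableT_comp.
- exact: indep_fun_comp.
Qed.

Lemma indep_integralM U V : indep_fun P U V ->
  P.-integrable setT (EFin \o U) -> P.-integrable setT (EFin \o V) ->
  \int[P]_t (U t * V t)%:E = \int[P]_t (U t)%:E * \int[P]_t (V t)%:E.
Proof.
move=> UV iU iV.
have [/measurable_EFinP mU _] := integrableP _ _ _ iU.
have [/measurable_EFinP mV _] := integrableP _ _ _ iV.
pose PU := distribution P (mfun_of mU).
pose PV := distribution P (mfun_of mV).
have mUV : measurable_fun setT (fun t => (U t, V t)) by exact: measurable_fun_pair.
pose h (z : R * R) : \bar R := (z.1 * z.2)%:E.
have mh : measurable_fun [set: R * R] h.
  by apply/measurable_EFinP; exact: measurable_funM.
have iUV : P.-integrable setT (h \o (fun t => (U t, V t))) by exact: indep_integrableM.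
have ih : (PU \x PV).-integrable setT h.
  apply/integrableP; split => //.
  rewrite -(law_pair_integral mU mV)// ge0_integral_pushforward//; last exact: measurableT_comp.
  by have /integrableP[] := iUV.
transitivity (\int[pushforward P (fun t => (U t, V t))]_z h z).
  by rewrite integral_pushforward.
rewrite (law_pair_integral mU mV)// -integral12_prod_meas1//.
have iPU : PU.-integrable setT EFin by apply: integrable_pushforward.
have iPV : PV.-integrable setT EFin by apply: integrable_pushforward.
rewrite /fubini_F /h /=.
have V_fin : \int[PV]_y y%:E \is a fin_num by exact: integrable_fin_num.
under eq_integral => x _.
  under eq_integral do rewrite EFinM.
  rewrite integralZl// -(fineK V_fin).
  over.
rewrite /= integralZr// fineK//.
by congr (_ * _); rewrite integral_pushforward.
Qed.

End product_expectation.

(** * Independent identically distributed arrays *)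

Section iid_array.
Context d (T : measurableType d) (R : realType) (P : probability T R)
  (X : nat * nat -> {RV P >-> R}).
Hypothesis indepX : mutually_independent X.
Hypothesis identX : identically_distributed X.
Local Open Scope ereal_scope.

Definition cylinder (J : seq (nat * nat)) (B : nat * nat -> set R) :=
  \bigcap_(a in [set` J]) X a @^-1` B a.

Lemma cylinder_nil B : cylinder [::] B = setT.
Proof. by rewrite /cylinder classical_sets.set_nil bigcap_set0. Qed.

Lemma cylinder_cons a J B : cylinder (a :: J) B = X a @^-1` B a `&` cylinder J B.
Proof.
rewrite /cylinder -(bigcap_setU1 (fun a => X a @^-1` B a)); congr (\bigcap_(_ in _) _).
apply/seteqP; split => b /=; rewrite inE.
  by move=> /orP[/eqP->|]; [left|right].
by move=> [->|->]; rewrite ?eqxx ?orbT.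
Qed.

Lemma measurable_cylinder J B : (forall a, measurable (B a)) -> measurable (cylinder J B).
Proof.
move=> mB; elim: J => [|a J IH]; first by rewrite cylinder_nil.
by rewrite cylinder_cons; apply: measurableI => //; exact: measurable_preimage.
Qed.

Lemma eq_cylinder J B B' : {in J, B =1 B'} -> cylinder J B = cylinder J B'.
Proof.
by move=> BB'; apply: eq_bigcapr => a aJ; rewrite BB'.
Qed.

Lemma indep_cylinder a J B : uniq (a :: J) -> (forall a, measurable (B a)) ->
  P (cylinder (a :: J) B) = P (X a @^-1` B a) * P (cylinder J B).
Proof.
move=> uaJ mB; rewrite /cylinder !indepX//; last by case/andP: uaJ.
by rewrite big_cons.
Qed.

Lemma indep_X a b : a != b -> indep_fun P (X a) (X b).
Proof.
move=> ab A B mA mB.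
pose B' c := if c == a then A else B.
have mB' c : measurable (B' c) by rewrite /B'; case: ifP.
have := @indep_cylinder a [:: b] B'.
rewrite /= inE ab => /(_ isT mB').
rewrite cylinder_cons /cylinder /= !classical_sets.set_cons1 !bigcap_set1.
by rewrite /B' eqxx eq_sym (negbTE ab).
Qed.

Section row_products.
Variables (i j : nat) (g : R * R -> R).
Hypothesis ij : i != j.
Hypothesis mg : measurable_fun setT g.

Let U k (t : T) := (X (k, i) t, X (k, j) t).

Definition row_prod m t := (\prod_(k < m) g (X (k : nat, i) t, X (k : nat, j) t))%R.

Let mU k : measurable_fun setT (U k).
Proof. by apply: measurable_fun_pair. Qed.

Lemma measurable_row_prod m : measurable_fun setT (row_prod m).
Proof.
elim: m => [|m IH].
  rewrite (_ : row_prod 0 = cst 1%R) //.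
  by apply/funext => t; rewrite /row_prod big_ord0.
rewrite (_ : row_prod m.+1 = (row_prod m \* (g \o U m))%R).
  by apply: measurable_funM => //; exact: measurableT_comp.
by apply/funext => t; rewrite /row_prod big_ord_recr.
Qed.

(** Mutual independence speaks of cylinders only. Quantifying over all cylinders on rows from [m] on
    makes the claim inductive: the two entries of row [m] can be adjoined to a cylinder on later
    rows. *)
Let past_indep m := forall J B A, uniq J -> {in J, forall a, (m <= a.1)%N} ->
  (forall a, measurable (B a)) -> measurable A ->
  P (row_prod m @^-1` A `&` cylinder J B) = P (row_prod m @^-1` A) * P (cylinder J B).

Let row_indep_past m : past_indep m ->
  forall J B A S, uniq J -> {in J, forall a, (m < a.1)%N} ->
  (forall a, measurable (B a)) -> measurable A -> measurable S ->
  P (U m @^-1` S `&` (row_prod m @^-1` A `&` cylinder J B)) =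
  P (U m @^-1` S) * P (row_prod m @^-1` A `&` cylinder J B).
Proof.
move=> pm J B A S uJ mJ mB mA mS.
have mWA : measurable (row_prod m @^-1` A).
  by apply: measurable_preimage => //; exact: measurable_row_prod.
apply: indep_pair_event => //; first by apply: measurableI => //; exact: measurable_cylinder.
move=> B1 B2 mB1 mB2.
(* Overriding [B] at the two entries of row [m] makes a rectangle event for [U m] part of a longer
   cylinder, to which [pm] applies; [i != j] keeps the two constraints apart. *)
pose B' a := if a == (m, i) then B1 else if a == (m, j) then B2 else B a.
have mB' a : measurable (B' a) by rewrite /B'; do !case: ifP.
have Bi : B' (m, i) = B1 by rewrite /B' eqxx.
have Bj : B' (m, j) = B2 by rewrite /B' !xpair_eqE !eqxx /= eq_sym (negbTE ij).
have BJ : cylinder J B = cylinder J B'.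
  apply: eq_cylinder => -[a b] aJ; have := mJ _ aJ; rewrite /B' /= !xpair_eqE.
  by move=> /gtn_eqF ->.
have nJ c : (m, c) \notin J by apply/negP => /mJ; rewrite ltnn.
have uJ' : uniq [:: (m, i), (m, j) & J].
  by rewrite /= inE !negb_or !nJ uJ xpair_eqE eqxx /= ij.
have pJ' : {in [:: (m, i), (m, j) & J], forall a, (m <= a.1)%N}.
  by move=> a; rewrite !inE => /or3P[/eqP->//|/eqP->//|/mJ/ltnW].
have pJ : {in J, forall a, (m <= a.1)%N} by move=> a /mJ/ltnW.
have := pm _ _ _ uJ' pJ' mB' mA.
rewrite indep_cylinder// indep_cylinder//; last by case/andP: uJ'.
rewrite !cylinder_cons Bi Bj -BJ.
rewrite (_ : _ `&` (_ `&` (_ `&` cylinder J B)) =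
  X (m, i) @^-1` B1 `&` X (m, j) @^-1` B2 `&` (row_prod m @^-1` A `&` cylinder J B)); last first.
  by rewrite setICA -setIA; congr (_ `&` _); rewrite setICA.
move=> ->; rewrite (indep_X _ mB1 mB2)//; last by rewrite xpair_eqE eqxx.
by rewrite pm// [LHS]muleCA -[RHS]muleA; congr (_ * _); exact: muleCA.
Qed.

Lemma row_prod_indep_future m : past_indep m.
Proof.
elim: m => [|m IH] J B A uJ mJ mB mA.
  have [A1|A1] := pselect (A 1%R).
    rewrite (_ : row_prod 0 @^-1` A = setT) ?setTI ?probability_setT ?mul1e//.
    by apply/seteqP; split => // t _ /=; rewrite /row_prod big_ord0.
  rewrite (_ : row_prod 0 @^-1` A = set0) ?set0I ?measure0 ?mul0e//.
  by apply/seteqP; split => // t /=; rewrite /row_prod big_ord0.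
(* A condition on the product of [m.+1] factors is a condition on the pair formed by the first [m]
   factors and row [m], so that [indep_pair_event] reduces it to rectangles. *)
pose S : set (R * (R * R)) := (fun z => z.1 * g z.2)%R @^-1` A.
have mS : measurable S.
  apply: measurable_preimage => //; apply: measurable_funM => //.
  exact: measurableT_comp.
rewrite (_ : row_prod m.+1 @^-1` A = (fun t => (row_prod m t, U m t)) @^-1` S); last first.
  by apply/seteqP; split => t /=; rewrite /row_prod big_ord_recr.
apply: indep_pair_event => //; first exact: measurable_row_prod.
  exact: measurable_cylinder.
move=> A' S' mA' mS'.
have H1 := row_indep_past IH uJ mJ mB mA' mS'.
have := @row_indep_past m IH [::] B A' S' isT _ mB mA' mS'.
rewrite cylinder_nil setIT => H2.
rewrite -setIA setICA.
by rewrite H1 [in RHS](setIC (row_prod m @^-1` A')) H2// IH ?muleA// => a /mJ/ltnW.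
Qed.

Lemma row_prod_indep_row m : indep_fun P (row_prod m) (fun t => g (U m t)).
Proof.
move=> A B mA mB.
have mS : measurable (g @^-1` B) by exact: measurable_preimage.
have := @row_indep_past m (@row_prod_indep_future m) [::] (fun=> setT) A _ isT _ _ mA mS.
rewrite cylinder_nil !setIT => H.
by rewrite setIC muleC; apply: H.
Qed.

Hypothesis g0 : forall z, (0 <= g z)%R.

(** Each row is independent of the product of the earlier ones, so expectations multiply. With an
    exponential [g] this is the factorization of a moment generating function. *)
Lemma integral_row_prod_le (c : R) m :
  (forall k, \int[P]_t (g (X (k, i) t, X (k, j) t))%:E <= c%:E) ->
  \int[P]_t (row_prod m t)%:E <= (c ^+ m)%:E.
Proof.
move=> gc; elim: m => [|m IH].
  rewrite expr0; under eq_integral do rewrite /row_prod big_ord0.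
  by rewrite integral_cst// mul1e probability_le1.
under eq_integral do rewrite /row_prod big_ord_recr /=.
rewrite indep_ge0_integralM//.
- rewrite exprSr EFinM lee_pmul//.
  + by apply: integral_ge0 => t _; rewrite lee_fin prodr_ge0.
  + by apply: integral_ge0 => t _; rewrite lee_fin.
- exact: measurable_row_prod.
- exact: (measurableT_comp mg (mU m)).
- exact: row_prod_indep_row.
- by move=> t; rewrite prodr_ge0.
Qed.

End row_products.

Lemma ident_ge0_integral (f : R -> \bar R) a b : measurable_fun setT f ->
  (forall x, 0 <= f x) -> \int[P]_t f (X a t) = \int[P]_t f (X b t).
Proof.
move=> mf f0.
have E c : \int[P]_t f (X c t) = \int[distribution P (X c)]_x f x.
  by rewrite ge0_integral_distribution.
rewrite !E; apply: eq_measure_integral => S mS _; exact: identX.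
Qed.

Lemma ident_integrable (f : R -> R) a b : measurable_fun setT f ->
  P.-integrable setT (fun t => (f (X a t))%:E) -> P.-integrable setT (fun t => (f (X b t))%:E).
Proof.
move=> mf /integrableP[_ fa]; apply/integrableP; split.
  by apply/measurable_EFinP; exact: measurableT_comp.
rewrite (le_lt_trans _ fa)// le_eqVlt; apply/orP; left; apply/eqP.
apply: (@ident_ge0_integral (fun x => `|(f x)%:E|)) => //.
by apply: measurableT_comp => //; exact/measurable_EFinP.
Qed.

Lemma ident_integral (f : R -> R) a b : measurable_fun setT f ->
  P.-integrable setT (fun t => (f (X a t))%:E) ->
  \int[P]_t (f (X a t))%:E = \int[P]_t (f (X b t))%:E.
Proof.
move=> mf fa.
have mEf : measurable_fun setT (EFin \o f) by exact/measurable_EFinP.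
have E c : \int[P]_t (f (X c t))%:E = \int[distribution P (X c)]_x (f x)%:E.
  by rewrite (@integral_distribution _ _ _ _ _ P (X c) (EFin \o f))//; exact: ident_integrable fa.
rewrite !E; apply: eq_measure_integral => S mS _; exact: identX.
Qed.

End iid_array.

(** * Truncation and the exponential inequality *)

Section real_estimates.
Context (R : realType).
Implicit Types (u v x y l : R).

Definition trunc y v := if `|v| <= y then v else 0.

Lemma truncN y v : trunc y (- v) = - trunc y v.
Proof. by rewrite /trunc normrN; case: ifP; rewrite ?oppr0. Qed.

Lemma trunc_id y v : `|v| <= y -> trunc y v = v.
Proof. by rewrite /trunc => ->. Qed.

Lemma measurable_trunc y : measurable_fun setT (trunc y).
Proof.
apply: measurable_fun_ifT => //.
by apply: measurable_fun_ler => //; exact: normr_measurable.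
Qed.

(** Multiplying [e^(-u) >= 1 - u] by [e^u] gives [e^u - 1 <= u e^u], hence
    [e^u - 1 - u <= u (e^u - 1)], and [|e^u - 1| <= |u| e^|u|]. *)
Lemma expR_le_quadratic u : expR u <= 1 + u + u ^+ 2 * expR `|u|.
Proof.
have uexp : expR u - 1 <= u * expR u.
  have := expR_ge1Dx (- u); rewrite -(ler_pM2l (expR_gt0 u)) expRxMexpNx_1; lra.
have [u0|u0] := leP 0 u.
  rewrite ger0_norm// expr2 -mulrA; nra.
have := expR_ge1Dx u.
have : 1 <= expR `|u| by rewrite (le_trans _ (expR_ge1Dx _))// lerDl.
have : expR u <= 1 by rewrite expR_le1 ltW.
move: (expR u) (expR `|u|) uexp => a b ab a1 b1 ua; nra.
Qed.

(* Where the truncation acts, [|v| > y] gives [l |v| <= l v^2 / y], so that the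
   truncated variable need not be recentered. *)
Lemma expR_trunc_le l y v : 0 < l -> 0 < y ->
  expR (l * trunc y v) <= 1 + l * v + v ^+ 2 * (l / y + l ^+ 2 * expR (l * y)).
Proof.
move=> l0 y0; rewrite /trunc; case: ifPn => [vy|].
  apply: (le_trans (expR_le_quadratic _)).
  rewrite lerD2l exprMn mulrDr (mulrC (l ^+ 2)) -mulrA.
  have h : expR `|l * v| <= expR (l * y) by rewrite ler_expR normrM gtr0_norm// ler_pM2l.
  have : 0 <= v ^+ 2 * (l / y) by rewrite mulr_ge0 ?sqr_ge0// divr_ge0// ltW.
  have : v ^+ 2 * (l ^+ 2 * expR `|l * v|) <= v ^+ 2 * (l ^+ 2 * expR (l * y)).
    by rewrite ler_wpM2l ?sqr_ge0// ler_wpM2l ?sqr_ge0.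
  lra.
rewrite -ltNge => yv; rewrite mulr0 expR0.
have : 0 <= v ^+ 2 * (l ^+ 2 * expR (l * y)) by apply: mulr_ge0 (sqr_ge0 _) (mulr_ge0 (sqr_ge0 _) (expR_ge0 _)).
have : l * `|v| <= v ^+ 2 * (l / y).
  rewrite -real_normK ?num_real// (_ : _ * (l / y) = l * `|v| * (`|v| / y)); last by ring.
  apply: ler_peMr; first by rewrite mulr_ge0// ltW.
  by rewrite ler_pdivlMr // mul1r ltW.
have : - (l * `|v|) <= l * v by rewrite -mulrN ler_pM2l// lerNl ler_normr lexx orbT.
rewrite mulrDr; lra.
Qed.

(* With [L = ln n] and [l = eta L / n^b], the linear term [l * eps n^b] is
   [4 L], while the correction terms are [O((1 + L)^2 n^(- t))]. *)
Lemma bennett_parameters b e s : 1 / 2 < b -> 0 < e -> 0 <= s ->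
  exists dl C, [/\ 0 < dl, 0 <= C & forall n, (2 <= n)%N -> exists2 l, 0 < l &
    (n%:R : R) * (s * (l / (dl * n%:R `^ b) + l ^+ 2 * expR (l * (dl * n%:R `^ b))))
      - l * (e * n%:R `^ b) <= C - 4 * ln (n%:R : R)].
Proof.
move=> hb e0 s0; pose t := (2 * b - 1) / 2; pose eta := 4 / e.
have t0 : 0 < t by rewrite /t; lra.
have eta0 : 0 < eta by rewrite divr_gt0.
(* With this choice [l * (dl * n^b) = t L]: the exponential costs a factor [n^t], which is only
   half, in the exponent, of the gain [n / n^(2 b) = n^(- 2 t)]. *)
pose dl := t / eta; have dl0 : 0 < dl by rewrite divr_gt0.
have tne : t != 0 by rewrite gt_eqF.
have ene : e != 0 by rewrite gt_eqF.
have etane : eta != 0 by rewrite gt_eqF.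
exists dl, (s * (eta / dl / t + eta ^+ 2 * (2 / t) ^+ 2)); split => //.
  by rewrite mulr_ge0// addr_ge0// ?mulr_ge0// ?sqr_ge0 ?invr_ge0 ?ltW.
move=> n n2; pose L : R := ln (n%:R : R).
have n0 : 0 < n%:R :> R by rewrite ltr0n (leq_trans _ n2).
have L0 : 0 < L by rewrite ln_gt0// ltr1n.
have nE : n%:R = expR L :> R by rewrite lnK.
have nb : (n%:R : R) `^ b = expR (b * L) by rewrite /powR gt_eqF.
rewrite -/L nb; set E := expR (b * L).
have E0 : 0 < E by exact: expR_gt0.
have Ene : E != 0 by rewrite gt_eqF.
have dlne : dl != 0 by rewrite gt_eqF.
exists (eta * L / E); first by rewrite divr_gt0// mulr_gt0.
have -> : eta * L / E * (dl * E) = t * L by rewrite /dl; field; rewrite ?Ene ?etane.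
have -> : eta * L / E * (e * E) = 4 * L by rewrite /eta; field; rewrite ?Ene ?ene.
rewrite lerD2r nE.
have -> : expR L * (s * (eta * L / E / (dl * E) + (eta * L / E) ^+ 2 * expR (t * L))) =
  s * (eta / dl * (L * (expR L / E ^+ 2)) + eta ^+ 2 * (L ^+ 2 * (expR L / E ^+ 2 * expR (t * L)))).
  by field; rewrite ?Ene ?dlne.
have F : expR L / E ^+ 2 = expR (- (2 * t * L)).
  by rewrite /E -expRM_natl -expRB; congr expR; rewrite /t; field.
rewrite F -expRD.
have h u : 0 < u -> L * expR (- (u * L)) <= u^-1.
  move=> u0; rewrite expRN ler_pdivrMr ?expR_gt0// ler_pdivlMl//.
  by rewrite (le_trans _ (expR_ge1Dx _))// lerDr.
rewrite ler_wpM2l// lerD//.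
  apply: ler_wpM2l; first by rewrite divr_ge0// ltW.
  apply: (le_trans (h _ _)); first by rewrite mulr_gt0.
  by rewrite lef_pV2 ?posrE ?mulr_gt0//; lra.
apply: ler_wpM2l; first exact: sqr_ge0.
(* The decay [n^(- t)] is shared equally by the two factors [L], so that [h] applies to each at rate
   [t / 2]. *)
have -> : L ^+ 2 * expR (- (2 * t * L) + t * L) = (L * expR (- (t / 2 * L))) ^+ 2.
  by rewrite exprMn -expRM_natl; congr (_ * expR _); field.
rewrite ler_sqr ?nnegrE; last 2 first.
- by apply: mulr_ge0 (ltW L0) (expR_ge0 _).
- by rewrite divr_ge0// ltW.
rewrite -[in leRHS]invf_div; apply: h; exact: divr_gt0.
Qed.

End real_estimates.

(** * Almost sure bounds for truncated sums *)

Section borel_cantelli_tools.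
Context d (T : measurableType d) (R : realType) (P : probability T R).
Local Open Scope ereal_scope.

Lemma measurable_set_ge (f : T -> R) (x : R) :
  measurable_fun setT f -> measurable [set t | (x <= f t)%R].
Proof.
move=> mf; rewrite (_ : [set t | _] = f @^-1` `[x, +oo[).
  exact: measurable_preimage.
by apply/seteqP; split => t /=; rewrite in_itv/= andbT.
Qed.

Lemma nneseries_lty (a : nat -> \bar R) (M : R) : (forall n, 0 <= a n) ->
  (forall N, \sum_(0 <= n < N) a n <= M%:E) -> \sum_(n <oo) a n < +oo.
Proof.
move=> a0 aM; apply: le_lt_trans (ltry M).
by apply: lime_le; [exact: is_cvg_nneseries|exact: nearW].
Qed.

(** The majorant telescopes, with partial sums [C (1 - 1 / (N + 1))]; it plays the role of a series
    with terms of order [1 / n^2]. *)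
Lemma nneseries_telescope_lty (a : nat -> \bar R) (C : R) : (forall n, 0 <= a n) ->
  (forall n, a n <= (C * (n.+1%:R * n.+2%:R)^-1)%:E) -> \sum_(n <oo) a n < +oo.
Proof.
move=> a0 aC.
have C0 : (0 <= C)%R.
  have := le_trans (a0 0%N) (aC 0%N); rewrite lee_fin; lra.
apply: (@nneseries_lty _ C) => // N.
apply: (@le_trans _ _ (C * (1 - N.+1%:R^-1))%:E); last first.
  by rewrite lee_fin -[leRHS]mulr1 ler_wpM2l// gerBl invr_ge0.
elim: N => [|N IH]; first by rewrite big_geq// invr1 subrr mulr0.
rewrite big_nat_recr//= (le_trans (leeD IH (aC N)))// -EFinD lee_fin.
rewrite le_eqVlt; apply/orP; left; apply/eqP.
have h1 : (N.+1%:R != 0 :> R)%R by rewrite pnatr_eq0.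
have h2 : (N.+2%:R != 0 :> R)%R by rewrite pnatr_eq0.
move: h1 h2; rewrite -(natr1 N.+1); move: (N.+1%:R : R)%R => x x0 x1.
by field; rewrite x0 x1.
Qed.

Lemma ae_eventually_not (F : nat -> set T) : (forall n, measurable (F n)) ->
  \sum_(n <oo) P (F n) < +oo ->
  {ae P, forall t, exists N, forall n, (N <= n)%N -> ~ F n t}.
Proof.
move=> mF sF; exists (lim_sup_set F); split.
- by apply: bigcap_measurable => // k _; exact: bigcup_measurable.
- exact: lim_sup_set_cvg0.
move=> t /= /forallNP h n _.
have /existsNP[m /not_implyP[nm /contrapT Fm]] := h n.
by exists m.
Qed.

Lemma Boole_bigcup_le (A : nat -> set T) m (c : R) : (forall i, measurable (A i)) ->
  (forall i, (i < m)%N -> P (A i) <= c%:E) ->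
  P (\bigcup_(i < m) A i) <= (m%:R * c)%:E.
Proof.
move=> mA Ac; rewrite bigcup_mkord (le_trans (Boole_inequality _ _))//.
rewrite (_ : (m%:R * c)%:E = \sum_(i < m) c%:E); last first.
  by rewrite sumEFin sumr_const card_ord mulr_natl.
by apply: lee_sum => i _; exact: Ac.
Qed.

End borel_cantelli_tools.

Section truncated_sums.
Context d (T : measurableType d) (R : realType) (P : probability T R)
  (X : nat * nat -> {RV P >-> R}).
Hypothesis indepX : mutually_independent X.
Local Open Scope ereal_scope.

(** One format for products of two centered entries and, with the second argument ignored, for
    functions of a single entry; [a != b] is what makes the product centered. *)
Definition centered_L2 (f : R * R -> R) (s : R) := forall a b, a != b ->
  [/\ P.-integrable setT (fun t => (f (X a t, X b t))%:E),
      \int[P]_t (f (X a t, X b t))%:E = 0,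
      P.-integrable setT (fun t => ((f (X a t, X b t)) ^+ 2)%:E) &
      \int[P]_t ((f (X a t, X b t)) ^+ 2)%:E <= s%:E].

Variables (f : R * R -> R) (s : R).
Hypothesis mf : measurable_fun setT f.
Hypothesis f_L2 : centered_L2 f s.

Let mfX a b : measurable_fun setT (fun t => f (X a t, X b t)).
Proof.
by apply: (measurableT_comp mf); exact: measurable_fun_pair.
Qed.

Lemma measurable_trunc_sum i j y n :
  measurable_fun setT (fun t => \sum_(k < n) trunc y (f (X (k : nat, i) t, X (k : nat, j) t)))%R.
Proof.
apply: measurable_sum => k.
exact: (measurableT_comp (measurable_trunc y) (mfX _ _)).
Qed.

(** Integrating [expR_trunc_le] kills the linear term, because [f] itself (not its truncation) is
    centered; what remains is [1 + s K <= e^(s K)]. *)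
Lemma trunc_mgf_le a b l y : a != b -> (0 < l)%R -> (0 < y)%R -> 
  \int[P]_t (expR (l * trunc y (f (X a t, X b t))))%:E <=
  (expR (s * (l / y + l ^+ 2 * expR (l * y))))%:E.
Proof.
move=> ab l0 y0; have [if1 f0 if2 fs] := f_L2 ab.
set K := (l / y + _)%R.
have K0 : (0 <= K)%R.
  by rewrite addr_ge0 ?divr_ge0 ?(ltW l0) ?(ltW y0)// mulr_ge0 ?sqr_ge0 ?expR_ge0.
apply: (@le_trans _ _ (\int[P]_t (1 + (l%:E * (f (X a t, X b t))%:E +
     K%:E * ((f (X a t, X b t)) ^+ 2)%:E)))).
  apply: ge0_le_integral => //.
  - apply/measurable_EFinP; apply: measurableT_comp => //; apply: measurable_funM => //.
    exact: (measurableT_comp (measurable_trunc y) (mfX _ _)).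
  - have m2 : measurable_fun setT (fun t =>
        1 + (l * f (X a t, X b t) + K * f (X a t, X b t) ^+ 2))%R.
      apply: measurable_funD => //; apply: measurable_funD; apply: measurable_funM => //.
      exact: (measurable_funX 2 (mfX _ _)).
    by move/measurable_EFinP : m2.
  - move=> t _; rewrite lee_fin; apply: (le_trans (expR_trunc_le _ l0 y0)).
    by rewrite -addrA (mulrC K).
have i1 : P.-integrable setT (fun t => l%:E * (f (X a t, X b t))%:E).
  exact: integrableZl.
have i2 : P.-integrable setT (fun t => K%:E * ((f (X a t, X b t)) ^+ 2)%:E).
  exact: integrableZl.
rewrite integralD//; last 2 first.
- exact: finite_measure_integrable_cst.
- exact: integrableD.
rewrite integralD// !integralZl// f0 mule0 add0e integral_cst// mul1e.
apply: (@le_trans _ _ (1 + K%:E * s%:E)).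
  by rewrite leeD ?probability_le1// lee_wpmul2l// lee_fin.
by rewrite -EFinM -EFinD lee_fin mulrC expR_ge1Dx.
Qed.

Lemma trunc_sum_tail i j l y x n : i != j -> (0 < l)%R -> (0 < y)%R ->
  P [set t | (x <= \sum_(k < n) trunc y (f (X (k : nat, i) t, X (k : nat, j) t)))%R] <=
  (expR (n%:R * (s * (l / y + l ^+ 2 * expR (l * y))) - l * x))%:E.
Proof.
move=> ij l0 y0; pose Y := mfun_of (measurable_trunc_sum i j y n).
apply: (le_trans (@chernoff _ _ _ P Y l x l0)).
rewrite expRD EFinM lee_wpmul2r ?lee_fin ?expR_ge0// /mmt_gen_fun expectation_def.
pose g z := expR (l * trunc y (f z)).
have mg : measurable_fun setT g.
  apply: measurableT_comp => //; apply: measurable_funM => //.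
  exact: (measurableT_comp (measurable_trunc y)).
have gc k := @trunc_mgf_le (k, i) (k, j) l y _ l0 y0.
have {gc} gc k : \int[P]_t (g (X (k, i) t, X (k, j) t))%:E <=
    (expR (s * (l / y + l ^+ 2 * expR (l * y))))%:E.
  by apply: gc => k0; rewrite xpair_eqE eqxx.
rewrite expRM_natl; apply: le_trans (integral_row_prod_le indepX ij mg _ n gc).
  rewrite le_eqVlt; apply/orP; left; apply/eqP; apply: eq_integral => t _ /=.
  by rewrite mulrC mulr_sumr expR_sum.
by move=> z; exact: expR_ge0.
Qed.

End truncated_sums.

Section truncated_sums_ae.
Context d (T : measurableType d) (R : realType) (P : probability T R)
  (X : nat * nat -> {RV P >-> R}).
Hypothesis indepX : mutually_independent X.
Local Open Scope ereal_scope.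

Lemma centered_L2N f s : measurable_fun setT f ->
  centered_L2 X f s -> centered_L2 X (\- f)%R s.
Proof.
move=> mf fL2 a b /fL2[i1 f0 i2 fs]; split.
- have /= := integrableN i1; apply: eq_integrable => // t _ /=; exact: EFinN.
- have /= := integralZl measurableT i1 (-1)%R; rewrite f0 mule0 => <-.
  by apply: eq_integral => t _; rewrite -EFinM mulN1r.
- by apply: eq_integrable i2 => // t _ /=; rewrite sqrrN.
- by under eq_integral do rewrite /= sqrrN.
Qed.

Variables (f : R * R -> R) (s : R).
Hypothesis mf : measurable_fun setT f.
Hypothesis f_L2 : centered_L2 X f s.

Lemma trunc_sum_abs_tail i j l y x n : i != j -> (0 < l)%R -> (0 < y)%R ->
  P [set t | (x <= `|\sum_(k < n) trunc y (f (X (k : nat, i) t, X (k : nat, j) t))|)%R] <=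
  (2 * expR (n%:R * (s * (l / y + l ^+ 2 * expR (l * y))) - l * x))%:E.
Proof.
move=> ij l0 y0.
have mNf : measurable_fun setT (\- f)%R by exact: measurable_funN.
have h1 := trunc_sum_tail indepX mf f_L2 x n ij l0 y0.
have h2 := trunc_sum_tail indepX mNf (centered_L2N mf f_L2) x n ij l0 y0.
rewrite mulr_natl mulr2n EFinD; apply: le_trans (leeD h1 h2).
have mge g : measurable_fun setT g -> measurable [set t | (x <= \sum_(k < n) trunc y
    (g (X (k : nat, i) t, X (k : nat, j) t)))%R].
  move=> mg; apply: measurable_set_ge; exact: (measurable_trunc_sum X mg).
apply: le_trans (measureU2 _ (mge _ mf) (mge _ mNf)).
apply: le_measure; rewrite ?inE.
- apply: measurable_set_ge.
  exact: (measurableT_comp (@normr_measurable R setT)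
    (measurable_trunc_sum X mf _ _ _ _)).
- by apply: measurableU; apply: mge.
move=> t /=; rewrite ler_normr => /orP[h|h]; [by left|right].
rewrite (le_trans h)// -sumrN; apply: ler_sum => k _.
by rewrite /= truncN.
Qed.

Lemma trunc_sums_ae_small (K : nat) b e : (1 / 2 < b -> 0 < e -> 0 <= s ->
  exists2 dl, 0 < dl & {ae P, forall t, exists N, forall n, (N <= n)%N ->
    forall i j, (i < K * n)%N -> (j < K * n)%N -> i != j ->
    `|\sum_(k < n) trunc (dl * n%:R `^ b) (f (X (k : nat, i) t, X (k : nat, j) t))|
      < e * n%:R `^ b})%R.
Proof.
move=> hb e0 s0; have [dl [C [dl0 C0 bnd]]] := bennett_parameters hb e0 s0.
exists dl => //.
pose E n i j : set T := if i == j then set0 else [set t | (e * n%:R `^ b <=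
  `|\sum_(k < n) trunc (dl * n%:R `^ b) (f (X (k : nat, i) t, X (k : nat, j) t))|)%R].
pose F n : set T := if (n < 2)%N then set0 else
  \bigcup_(i < (K * n)%N) \bigcup_(j < (K * n)%N) E n i j.
have mE n i j : measurable (E n i j).
  rewrite /E; case: ifP => // _.
  apply: measurable_set_ge.
  exact: (measurableT_comp (@normr_measurable R setT)
    (measurable_trunc_sum X mf _ _ _ _)).
have mF n : measurable (F n).
  rewrite /F; case: ifP => // _.
  by apply: bigcup_measurable => i _; exact: bigcup_measurable.
have PE n i j : (2 <= n)%N -> P (E n i j) <= (2 * (expR C / n%:R ^+ 4))%:E.
  move=> n2; rewrite /E; case: (eqVneq i j) => [_|ij].
    by rewrite measure0 lee_fin mulr_ge0// divr_ge0 ?expR_ge0 ?exprn_ge0.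
  have [l l0 hl] := bnd _ n2.
  have n0 : (0 < n%:R :> R)%R by rewrite ltr0n (leq_trans _ n2).
  apply: (le_trans (trunc_sum_abs_tail _ _ ij l0 _)).
    by rewrite mulr_gt0// powR_gt0.
  rewrite lee_fin ler_pM2l// -[X in (X ^+ 4)%R](@lnK R n%:R)// -expRM_natl -expRB.
  by rewrite ler_expR.
have sF : \sum_(n <oo) P (F n) < +oo.
  (* The constant 6 comes from [2 / n^2 <= 6 / ((n + 1) (n + 2))] for [n >= 2], an equality at
     [n = 2]. *)
  apply: (@nneseries_telescope_lty _ _ (6 * (K%:R ^+ 2 * expR C))) => // n.
  rewrite /F; case: ltnP => n2.
    by rewrite measure0 lee_fin mulr_ge0 ?invr_ge0 ?mulr_ge0 ?sqr_ge0 ?expR_ge0.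
  apply: (@le_trans _ _ ((K * n)%:R * ((K * n)%:R * (2 * (expR C / n%:R ^+ 4))))%:E).
    apply: Boole_bigcup_le => i.
      by apply: bigcup_measurable.
    by move=> _; apply: Boole_bigcup_le => // j _; exact: PE.
  have n0 : (n%:R != 0 :> R)%R by rewrite pnatr_eq0 -lt0n (leq_trans _ n2).
  rewrite lee_fin natrM.
  have -> : (K%:R * n%:R * (K%:R * n%:R * (2 * (expR C / n%:R ^+ 4))) =
     K%:R ^+ 2 * expR C * (2 / n%:R ^+ 2) :> R)%R by field.
  rewrite (mulrC 6%R) -[leRHS]mulrA; apply: ler_wpM2l.
    by rewrite mulr_ge0 ?sqr_ge0 ?expR_ge0.
  have n0' : (0 < n%:R :> R)%R by rewrite ltr0n (leq_trans _ n2).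
  rewrite ler_pdivrMr ?exprn_gt0// mulrAC ler_pdivlMr ?mulr_gt0//.
  have : (2 <= n%:R :> R)%R by rewrite ler_nat.
  by rewrite -(natr1 n.+1) -(natr1 n); move: (n%:R : R)%R => x; nra.
have [N0 [mN0 PN0 hN]] := ae_eventually_not mF sF.
exists N0; split => // t /= ht; apply: hN => /= -[N hNt]; apply: ht.
exists (maxn N 2) => n; rewrite geq_max => /andP[Nn n2] i j iK jK ij.
rewrite ltNge; apply/negP => h; apply: (hNt n Nn).
rewrite /F ltnNge n2 /=; exists i => //; exists j => //.
by rewrite /E (negbTE ij).
Qed.

End truncated_sums_ae.

(** * Laws of finite rows *)

Section tuple_laws.
Context d (T : measurableType d) (R : realType) (n : nat).
Local Open Scope ereal_scope.

Let box (B : 'I_n -> set R) : set (n.-tuple R) := [set v | forall i, B i (tnth v i)].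

Let measurable_box B : (forall i, measurable (B i)) -> measurable (box B).
Proof.
move=> mB; rewrite (_ : box B = \bigcap_(i in [set: 'I_n]) (@tnth n R ^~ i) @^-1` B i).
  apply: fin_bigcap_measurable => // i _.
  by apply: measurable_preimage => //; exact: measurable_tnth.
by apply/seteqP; split => v /= h i => [_|]; exact: h.
Qed.

(** Boxes form a pi-system, and each generator of the tuple sigma-algebra, a condition on one
    coordinate, is a box whose other sides are [setT]. *)
Lemma measure_tuple_eq (m1 m2 : {measure set (n.-tuple R) -> \bar R}) :
  m1 setT < +oo ->
  (forall B : 'I_n -> set R, (forall i, measurable (B i)) ->
    m1 [set v | forall i, B i (tnth v i)] = m2 [set v | forall i, B i (tnth v i)]) ->
  forall S, measurable S -> m1 S = m2 S.
Proof.
move=> m1oo m12 S mS.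
pose C : set (set (n.-tuple R)) := [set box B | B in [set B | forall i, measurable (B i)]].
apply: (measure_unique C (fun=> setT)) => //.
- apply/seteqP; split.
    apply: smallest_sub; first exact: smallest_sigma_algebra.
    rewrite -bigcup_seq; apply: bigcup_sub => i _ _ [A mA <-].
    apply: sub_sigma_algebra.
    exists (fun k => if k == i then A else setT); first by move=> k /=; case: ifP.
    rewrite setTI; apply/seteqP; split => v /=.
      by move=> /(_ i); rewrite eqxx.
    by move=> Av k; case: eqP => // ->.
  apply: smallest_sub; first exact: sigma_algebra_measurable.
  by move=> _ [B mB <-]; exact: measurable_box.
- move=> _ _ [A mA <-] [B mB <-]; exists (fun i => A i `&` B i).
    by move=> i; exact: measurableI.
  by apply/seteqP; split => v /= => [h|[hA hB] i]; [split => i; have [] := h i|split].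
- by move=> _; exists (fun=> setT) => //; apply/seteqP; split.
- by rewrite bigcup_const.
- by move=> _ [B mB <-]; exact: m12.
Qed.

End tuple_laws.

Section exchangeability.
Context d (T : measurableType d) (R : realType) (P : probability T R)
  (X : nat * nat -> {RV P >-> R}).
Hypothesis indepX : mutually_independent X.
Hypothesis identX : identically_distributed X.
Local Open Scope ereal_scope.

(** The right-hand side does not depend on [phi], which is the source of exchangeability.
    Injectivity makes the list [J] of visited entries duplicate-free, and the position in [J]
    recovers the index of the side of the box. *)
Lemma prob_box n (phi : nat -> nat * nat) (B : nat -> set R) :
  {in [pred k | (k < n)%N] &, injective phi} -> (forall i, measurable (B i)) ->
  P (\bigcap_(i < n) X (phi i) @^-1` B i) =
  \prod_(i < n) P (X (0%N, 0%N) @^-1` B i).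
Proof.
move=> phi_inj mB; pose J := map phi (iota 0 n).
have uJ : uniq J.
  by rewrite map_inj_in_uniq ?iota_uniq// => a b; rewrite !mem_iota; exact: phi_inj.
have nthJ i : (i < n)%N -> nth (0%N, 0%N) J i = phi i.
  by move=> ni; rewrite (nth_map 0%N) ?size_iota// nth_iota.
have idx i : (i < n)%N -> index (phi i) J = i.
  by move=> ni; rewrite -(nthJ i ni) index_uniq// size_map size_iota.
rewrite (_ : \bigcap_(i < n) _ = \bigcap_(a in [set` J]) X a @^-1` B (index a J)); last first.
  apply/seteqP; split => t /= h.
    move=> a /mapP[i + ->]; rewrite mem_iota/= => ni.
    by rewrite idx//; exact: h.
  move=> i ni; have := h (phi i); rewrite /= idx//; apply.
  by apply/mapP; exists i => //; rewrite mem_iota.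
rewrite (indepX uJ (fun a => mB (index a J))) big_map -[in LHS](subn0 n) -/(index_iota 0 n).
rewrite big_mkord; apply: eq_bigr => i _.
by rewrite idx//; exact: identX.
Qed.

Let row_tuple n (phi : nat -> nat * nat) t : n.-tuple R :=
  [tuple X (phi (i : nat)) t | i < n].

Let measurable_row_tuple n phi : measurable_fun setT (row_tuple n phi).
Proof.
apply/measurable_fun_tnthP => i.
rewrite (_ : _ \o _ = X (phi i)) //.
by apply/funext => t /=; rewrite tnth_mktuple.
Qed.

Lemma eq_tuple_law n phi psi (S : set (n.-tuple R)) :
  {in [pred k | (k < n)%N] &, injective phi} ->
  {in [pred k | (k < n)%N] &, injective psi} -> measurable S ->
  P [set t | S [tuple X (phi (i : nat)) t | i < n]] =
  P [set t | S [tuple X (psi (i : nat)) t | i < n]].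
Proof.
move=> phi_inj psi_inj mS.
pose m1 : {measure set (n.-tuple R) -> \bar R} := pushforward P (row_tuple n phi).
pose m2 : {measure set (n.-tuple R) -> \bar R} := pushforward P (row_tuple n psi).
suff : m1 (measurable_row_tuple phi) S = m2 (measurable_row_tuple psi) S by [].
apply: measure_tuple_eq => //.
  by rewrite /m1 /= /pushforward preimage_setT probability_setT ltry.
have E f B : {in [pred k | (k < n)%N] &, injective f} ->
    (forall i : 'I_n, measurable (B i)) ->
    P (row_tuple n f @^-1` [set v | forall i, B i (tnth v i)]) =
    \prod_(i < n) P (X (0%N, 0%N) @^-1` B i).
  move=> f_inj mB.
  pose B' k := if insub k is Some i then B i else setT.
  have B'E (i : 'I_n) : B' i = B i by rewrite /B' valK.
  have mB' i : measurable (B' i) by rewrite /B'; case: insub.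
  transitivity (\prod_(i < n) P (X (0%N, 0%N) @^-1` B' i)).
    rewrite -(prob_box f_inj mB'); congr (P _); apply/seteqP; split => t /=.
      move=> h i ni; have := h (Ordinal ni); rewrite tnth_mktuple /=.
      by rewrite -B'E.
    by move=> h i; rewrite tnth_mktuple -B'E; exact: (h i (ltn_ord i)).
  by apply: eq_bigr => i _; rewrite B'E.
by move=> B mB; rewrite /m1 /m2 /= /pushforward !E.
Qed.

(** The enumeration [phi] of entries is a parameter so that the event can be moved between rows and
    between blocks of columns. *)
Definition prod_exceeds (phi : nat -> nat * nat) n (x : R) : set T :=
  [set t | exists i j, [/\ (i < j)%N, (j < n)%N & (x <= `|X (phi i) t * X (phi j) t|)%R]].

Let exceeds_set n (x : R) : set (n.-tuple R) :=
  \bigcup_(i in [set: 'I_n]) \bigcup_(j in [set j : 'I_n | (i < j)%N])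
    [set v | (x <= `|tnth v i * tnth v j|)%R].

Let measurable_exceeds_set n x : measurable (@exceeds_set n x).
Proof.
apply: fin_bigcup_measurable => // i _; apply: fin_bigcup_measurable => // j _.
apply: (@measurable_set_ge _ (n.-tuple R) R (fun v => `|tnth v i * tnth v j|%R)).
apply: measurableT_comp => //; apply: measurable_funM; exact: measurable_tnth.
Qed.

Let prod_exceedsE phi n x : prod_exceeds phi n x =
  [set t | exceeds_set x [tuple X (phi (i : nat)) t | i < n]].
Proof.
apply/seteqP; split => t /=.
  move=> [i [j [ij jn h]]].
  exists (Ordinal (ltn_trans ij jn)) => //; exists (Ordinal jn) => //=.
  by rewrite !tnth_mktuple.
move=> [i _ [j /= ij]]; rewrite !tnth_mktuple => h.
by exists i, j.
Qed.

Lemma measurable_prod_exceeds phi n x : measurable (prod_exceeds phi n x).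
Proof.
rewrite prod_exceedsE.
exact: (measurable_preimage (measurable_row_tuple phi) (@measurable_exceeds_set n x)).
Qed.

Lemma eq_prob_prod_exceeds phi psi n x :
  {in [pred k | (k < n)%N] &, injective phi} ->
  {in [pred k | (k < n)%N] &, injective psi} ->
  P (prod_exceeds phi n x) = P (prod_exceeds psi n x).
Proof.
by move=> phi_inj psi_inj; rewrite !prod_exceedsE; exact: eq_tuple_law.
Qed.

Lemma prod_exceeds_sub phi m n x y : (m <= n)%N -> (y <= x)%R ->
  prod_exceeds phi m x `<=` prod_exceeds phi n y.
Proof.
move=> mn yx t [i [j [ij jm h]]]; exists i, j; split => //.
  exact: leq_trans jm mn.
exact: le_trans h.
Qed.


(** Positivity of [x] matters because the empty maximum has the default value 0. *)
Lemma prod_exceeds_max_prod_row n x : (0 < x)%R ->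
  prod_exceeds (pair 0%N) n x = [set t | (x <= max_prod_row (fun k i => X (k, i) t) n)%R].
Proof.
move=> x0; apply/seteqP; split => t /=.
  move=> [i [j [ij jn h]]]; apply: (le_trans h).
  rewrite /max_prod_row.
  apply: (le_trans _ (@le_bigmax _ _ _ _ _ (Ordinal jn))) => /=.
  exact: (le_trans _ (@le_bigmax _ _ _ _ _ (Ordinal ij))).
move=> h; apply: contrapT => hN; move: h; apply/negP; rewrite -ltNge.
apply: bigmax_lt => // j _; apply: bigmax_lt => // i _.
rewrite ltNge; apply/negP => h; apply: hN.
by exists i, j.
Qed.

End exchangeability.

(** * Dyadic summation *)

Section dyadic.
Context d (T : measurableType d) (R : realType) (P : probability T R).
Local Open Scope ereal_scope.

Lemma natmul_ge0 (x : \bar R) k : 0 <= x -> (x *+ k)%R = k%:R%:E * x.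
Proof.
move=> x0; elim: k => [|k IH]; first by rewrite mulr0n mul0e.
by rewrite mulrSr IH -natr1 EFinD ge0_muleDl ?lee_fin// mul1e.
Qed.

(** Cauchy condensation: the block from [2^(m+1)] to [2^(m+2)] has at least [2^m] indices, and [b m]
    is below each of its terms. *)
Lemma dyadic_series_lty (a b : nat -> \bar R) : (forall n, 0 <= a n) ->
  (forall m n, (2 ^ m.+1 <= n < 2 ^ m.+2)%N -> b m <= a n) ->
  \sum_(n <oo) a n < +oo -> (forall m, 0 <= b m) ->
  \sum_(m <oo) (2 ^ m)%:R%:E * b m < +oo.
Proof.
move=> a0 ba sa b0; apply: le_lt_trans sa.
apply: lime_le; first by apply: is_cvg_nneseries => m _ _; rewrite mule_ge0.
apply: nearW => M.
apply: (@le_trans _ _ (\sum_(0 <= n < 2 ^ M.+1) a n)); last first.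
  exact: nneseries_lim_ge.
elim: M => [|M IH]; first by rewrite big_geq// sume_ge0.
have h1 : (0 <= 2 ^ M.+1)%N by [].
have h2 : (2 ^ M.+1 <= 2 ^ M.+2)%N by rewrite leq_exp2l.
rewrite big_nat_recr//= (big_cat_nat h1 h2)/=.
apply: leeD => //.
apply: (@le_trans _ _ (\sum_(2 ^ M.+1 <= n < 2 ^ M.+2) b M)).
  rewrite sumr_const_nat natmul_ge0// lee_wpmul2r// lee_fin ler_nat !expnS; lia.
by rewrite !big_nat; apply: lee_sum => n /ba.
Qed.

Lemma powR_nat_unbounded (al M : R) : (0 < al -> exists l : nat, M <= (2 ^ l)%:R `^ al)%R.
Proof.
move=> al0; pose n := Num.bound (`|M| `^ al^-1)%R.
exists n; apply: (le_trans (ler_norm M)).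
have -> : `|M|%R = ((`|M| `^ al^-1) `^ al)%R.
  by rewrite -powRrM mulVf ?powRr1 ?gt_eqF.
apply: ge0_ler_powR; rewrite ?nnegrE ?powR_ge0//; first exact: ltW.
have h := archi_boundP (powR_ge0 `|M|%R al^-1).
by rewrite (le_trans (ltW h))// ler_nat ltnW// ltn_expl.
Qed.

(** For [2^m <= n < 2^(m+1)] the event is compared with term [m - l] of the series. As
    [dl * 2^(l al) >= 4^al], the threshold [dl * n^al] is at least [(2^(m-l+2))^al]. A small [dl]
    thus costs only a fixed dyadic shift, which is why summability is asked for every [l]. *)
Lemma dyadic_ae (bad : nat -> R -> set T) (al dl : R) : (0 < al)%R -> (0 < dl)%R ->
  (forall n x, measurable (bad n x)) ->
  (forall m n x y, (m <= n)%N -> (y <= x)%R -> bad m x `<=` bad n y) ->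
  (forall l, \sum_(m <oo) P (bad (2 ^ (m + l).+1)%N ((2 ^ m.+2)%:R `^ al)%R) < +oo) ->
  {ae P, forall t, exists N, forall n, (N <= n)%N -> ~ bad n (dl * n%:R `^ al)%R t}.
Proof.
move=> al0 dl0 mbad bad_mono sbad.
have [l hl] := powR_nat_unbounded (4%:R `^ al / dl) al0.
have := ae_eventually_not (fun m => mbad _ _) (sbad l).
apply: filterS => t [N hN]; exists (2 ^ (N + l))%N => n Nn bt.
have n0 : (0 < n)%N by apply: leq_trans Nn; rewrite expn_gt0.
pose m := trunc_log 2 n.
have /andP[mn nm] := @trunc_log_bounds 2 n isT n0.
have Nlm : (N + l <= m)%N by exact: trunc_log_max.
have lm : (l <= m)%N by apply: leq_trans Nlm; exact: leq_addl.
have Nml : (N <= m - l)%N by rewrite leq_subRL// addnC.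
apply: (hN _ Nml); apply: bad_mono bt; first by rewrite subnK// ltnW.
have -> : ((2 ^ (m - l).+2)%:R = 4%:R * (2 ^ (m - l))%:R :> R)%R.
  by rewrite -natrM; congr (_%:R)%R; rewrite !expnS mulnA.
rewrite powRM//; apply: (@le_trans _ _ (dl * (2 ^ m)%:R `^ al)%R).
  have -> : ((2 ^ m)%:R = (2 ^ l)%:R * (2 ^ (m - l))%:R :> R)%R.
    by rewrite -natrM -expnD subnKC.
  rewrite powRM// mulrA; apply: ler_wpM2r; first exact: powR_ge0.
  by rewrite mulrC -ler_pdivrMr.
rewrite ler_pM2l//; apply: ge0_ler_powR; rewrite ?nnegrE ?ler_nat//.
exact: ltW.
Qed.

End dyadic.

(** * Almost sure bounds for products of two entries *)

Section blocks.
Context d (T : measurableType d) (R : realType) (P : probability T R)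
  (X : nat * nat -> {RV P >-> R}).
Hypothesis indepX : mutually_independent X.
Hypothesis identX : identically_distributed X.
Local Open Scope ereal_scope.

(* Two entries of row [k] with column indices below [D * N] lie in the union of
   two blocks of length [N]; [D] serves as a spare block when both lie in the
   same one. *)
Let two_blocks (D N k u v s : nat) : nat * nat :=
  (k, if (s < N)%N then (u * N + s)%N
      else ((if u == v then D else v) * N + (s - N))%N).

Let two_blocks_inj D N k u v : (u < D)%N ->
  {in [pred s | (s < 2 * N)%N] &, injective (two_blocks D N k u v)}.
Proof.
move=> uD s s'; rewrite !inE /two_blocks => s2 s'2 [].
have [N0|N0] := posnP N; first by move: s2; rewrite N0.
have uv : (u == (if u == v then D else v)) = false.
  by case: (eqVneq u v) => [_|/negbTE//]; rewrite ltn_eqF.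
move: (if u == v then D else v) uv => w uw.
have blk a b c e : (b < N)%N -> (e < N)%N -> (a * N + b = c * N + e)%N -> a = c.
  move=> bN eN /(congr1 (divn^~ N)); rewrite !divnMDl// !divn_small// !addn0.
  by [].
case: (ltnP s N) => sN; case: (ltnP s' N) => s'N.
- by move/addnI.
- by move/blk => /(_ sN) h; move/eqP: uw; case; apply: h; lia.
- by move/esym/blk => /(_ s'N) h; move/eqP: uw; case; apply: h; lia.
- by move/addnI; lia.
Qed.

(** Two columns below [D * N] fall into one of [D^2] two-block enumerations. Each visits [2 * N]
    distinct entries, hence has the law of the first [2 * N] entries of row 0. *)
Lemma prob_prod_exceeds_row_le D N k x : (0 < N)%N ->
  P (prod_exceeds X (pair k) (D * N) x) <=
  (D%:R * (D%:R * fine (P (prod_exceeds X (pair 0%N) (2 * N) x))))%:E.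
Proof.
move=> N0.
have sub : prod_exceeds X (pair k) (D * N) x `<=`
    \bigcup_(u < D) \bigcup_(v < D) prod_exceeds X (two_blocks D N k u v) (2 * N) x.
  move=> t [i [j [ij jDN h]]].
  have iD : (i %/ N < D)%N by rewrite ltn_divLR// (ltn_trans ij).
  have jD : (j %/ N < D)%N by rewrite ltn_divLR.
  exists (i %/ N)%N => //; exists (j %/ N)%N => //.
  have iE : two_blocks D N k (i %/ N) (j %/ N) (i %% N) = (k, i).
    by rewrite /two_blocks ltn_mod N0 -divn_eq.
  have [ijN|ijN] := eqVneq (i %/ N)%N (j %/ N)%N.
    have jE : two_blocks D N k (i %/ N) (j %/ N) (j %% N) = (k, j).
      by rewrite /two_blocks ltn_mod N0 ijN -divn_eq.
    exists (i %% N)%N, (j %% N)%N; rewrite iE jE; split => //.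
      by move: ij; rewrite {1}(divn_eq i N) {1}(divn_eq j N) ijN ltn_add2l.
    by rewrite (leq_trans (ltn_pmod _ N0))// leq_pmull.
  have jE : two_blocks D N k (i %/ N) (j %/ N) (N + j %% N) = (k, j).
    by rewrite /two_blocks (negbTE ijN) ltnNge leq_addr /= addKn -divn_eq.
  exists (i %% N)%N, (N + j %% N)%N; rewrite iE jE; split => //.
    by rewrite (leq_trans (ltn_pmod _ N0))// leq_addr.
  by rewrite mul2n -addnn ltn_add2l ltn_pmod.
have mpe phi n y := measurable_prod_exceeds X phi n y.
apply: (@le_trans _ _ (P (\bigcup_(u < D) \bigcup_(v < D)
    prod_exceeds X (two_blocks D N k u v) (2 * N) x))).
  by apply: le_measure => //; rewrite inE//; do 2 apply: bigcup_measurable => ? _.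
apply: Boole_bigcup_le => [u|u uD]; first exact: bigcup_measurable.
apply: Boole_bigcup_le => // v vD.
rewrite fineK ?fin_num_measure//.
rewrite (@eq_prob_prod_exceeds _ _ _ _ _ indepX identX _ (pair 0%N))//.
  exact: two_blocks_inj.
by move=> a b _ _ [].
Qed.

Variable al : R.
Hypothesis al0 : (0 < al)%R.
Hypothesis sumX :
  \sum_(n <oo) P (prod_exceeds X (pair 0%N) n (n%:R `^ al)%R) < +oo.

Lemma products_ae_small (K : nat) (dl : R) : (0 < dl)%R ->
  {ae P, forall t, exists N, forall n, (N <= n)%N -> forall k i j,
    (k < n)%N -> (i < j)%N -> (j < K * n)%N ->
    (`|X (k, i) t * X (k, j) t| < dl * n%:R `^ al)%R}.
Proof.
move=> dl0.
pose bad n x : set T := \bigcup_(k < n) prod_exceeds X (pair k) (K * n) x.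
have mbad n x : measurable (bad n x).
  by apply: bigcup_measurable => k _; exact: measurable_prod_exceeds.
have bad_mono m n x y : (m <= n)%N -> (y <= x)%R -> bad m x `<=` bad n y.
  move=> mn yx t [k /= km h]; exists k; first exact: leq_trans mn.
  by apply: prod_exceeds_sub h => //; rewrite leq_mul2l mn orbT.
have sbad l : \sum_(m <oo) P (bad (2 ^ (m + l).+1)%N ((2 ^ m.+2)%:R `^ al)%R) < +oo.
  (* Two blocks of length [2^m] with threshold [(2^(m+2))^al]: this probability is below the term of
     [sumX] at every [n] from [2^(m+1)] to [2^(m+2)]. *)
  pose b m := P (prod_exceeds X (pair 0%N) (2 ^ m.+1) ((2 ^ m.+2)%:R `^ al)%R).
  have sb : \sum_(m <oo) (2 ^ m)%:R%:E * b m < +oo.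
    apply: (dyadic_series_lty _ _ sumX) => // m n /andP[mn nm].
    apply: le_measure; rewrite ?inE; try exact: measurable_prod_exceeds.
    apply: prod_exceeds_sub => //.
    by apply: ge0_ler_powR; rewrite ?nnegrE ?ler_nat//; [exact: ltW|exact: ltnW].
  (* [D] is free of [m], so each row costs the fixed factor [D^2], and the [2^(m+l+1)] rows give, up
     to a constant, the weight [2^m] of the condensed series. *)
  pose D := (K * 2 ^ l.+1)%N.
  pose C : R := ((2 ^ l.+1)%:R * (D%:R * D%:R))%R.
  apply: (@le_lt_trans _ _ (\sum_(m <oo) C%:E * ((2 ^ m)%:R%:E * b m))).
    apply: lee_nneseries => // m _.
    have DN : (K * 2 ^ (m + l).+1 = D * 2 ^ m)%N by rewrite /D -mulnA -expnD addSn addnC.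
    apply: le_trans (@Boole_bigcup_le _ _ _ P _ _ (D%:R * (D%:R * fine (b m)))%R _ _) _.
    - by move=> k; exact: measurable_prod_exceeds.
    - move=> k _; rewrite DN /b (expnS 2 m).
      by apply: prob_prod_exceeds_row_le; rewrite expn_gt0.
    have -> : b m = (fine (b m))%:E.
      by rewrite fineK// fin_num_measure//; exact: measurable_prod_exceeds.
    rewrite -!EFinM lee_fin /C /= le_eqVlt; apply/orP; left; apply/eqP.
    rewrite -addnS expnD natrM; ring.
  rewrite nneseriesZl//; last by move=> m _; rewrite mule_ge0.
  by apply: lte_mul_pinfty => //; rewrite lee_fin !mulr_ge0.
have := dyadic_ae al0 dl0 mbad bad_mono sbad.
apply: filterS => t [N hN]; exists N => n Nn k i j kn ij jn.
rewrite ltNge; apply/negP => h; apply: (hN n Nn).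
by exists k => //; exists i, j.
Qed.

End blocks.

(** * Tails of a single entry *)

Section nondegenerate.
Context d (T : measurableType d) (R : realType) (P : probability T R)
  (Y : {RV P >-> R}).
Hypothesis ndY : nondegenerate_rv Y.
Local Open Scope ereal_scope.

Lemma nondegenerate_not_ae (c : R) : ~ {ae P, forall t, Y t = c}.
Proof.
move=> aeYc; apply: ndY; exists c.
have mYc : measurable [set t | Y t = c].
  exact: (measurable_preimage (measurable_funP Y) (measurable_set1 c)).
have : P (~` [set t | Y t = c]) = 0 by apply/negligibleP => //; exact: measurableC.
by rewrite probability_setC// => /eqP; rewrite sube_eq ?fin_num_measure// ?add0e => /eqP.
Qed.

(** Otherwise [|Y| < 1 / (k + 1)] almost surely for every [k], so that [Y] vanishes almost
    surely. *)
Lemma nondegenerate_tail : exists2 c : R, (0 < c)%R & 0 < P [set t | (c <= `|Y t|)%R].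
Proof.
apply: contrapT => h; apply: (@nondegenerate_not_ae 0%R).
have mge (c : R) : measurable [set t | (c <= `|Y t|)%R].
  by apply: measurable_set_ge; apply: measurableT_comp => //.
have h0 (k : nat) : \forall t \ae P, (`|Y t| < k.+1%:R^-1)%R.
  exists [set t | (k.+1%:R^-1 <= `|Y t|)%R]; split => //; last first.
    by move=> t /= /negP; rewrite -leNgt.
  apply/eqP; rewrite -measure_le0 leNgt; apply/negP => p0; apply: h.
  by exists k.+1%:R^-1%R.
have := ae_foralln h0; apply: filterS => t ht.
apply/eqP; rewrite -normr_le0; apply/ler_addgt0Pl => e e0; rewrite addr0.
have [k _ hk] : exists2 k : nat, True & (k.+1%:R^-1 <= e)%R.
  have hb : (e^-1 < (Num.bound e^-1)%:R)%R.
    by apply: archi_boundP; rewrite invr_ge0 ltW.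
  exists (Num.bound e^-1) => //.
  rewrite -[leRHS]invrK lef_pV2 ?posrE ?invr_gt0//.
  by apply: le_trans (ltW hb) _; rewrite ler_nat.
exact: le_trans (ltW (ht k)) hk.
Qed.

End nondegenerate.

Section tails.
Context d (T : measurableType d) (R : realType) (P : probability T R)
  (X : nat * nat -> {RV P >-> R}).
Hypothesis indepX : mutually_independent X.
Hypothesis identX : identically_distributed X.
Local Open Scope ereal_scope.

Lemma small_terms (a : nat -> \bar R) (e : R) : (forall n, 0 <= a n) ->
  \sum_(n <oo) a n < +oo -> (0 < e)%R -> exists N, forall n, (N <= n)%N -> a n <= e%:E.
Proof.
move=> a0 sa e0.
have /fine_cvgP[tfin /cvgrPdist_lt/(_ _ e0)[N _ hN]] :=
  nneseries_tail_cvg sa (fun k _ => a0 k).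
have [M _ hM] := tfin.
exists (maxn N M) => n; rewrite geq_max => /andP[Nn Mn].
have := hN n Nn; rewrite /= sub0r normrN => h.
apply: (@le_trans _ _ (\sum_(n <= k <oo) a k)).
  have /= := @nneseries_lim_ge R a xpredT n n.+1 (fun k _ _ => a0 k).
  by rewrite big_nat1.
rewrite -(fineK (hM n Mn)) lee_fin; apply: le_trans (ltW h); exact: ler_norm.
Qed.

(** A reverse union bound for [N] independent events of probability [q] whose union is not too
    likely. From [(1 - q)^N (1 + N q) <= 1] follows [a N q <= 1 - a] with [a = (1 - q)^N >= 1/2]. *)
Lemma geometric_union_bound (q : R) N : (0 <= q <= 1 -> 1 / 2 <= (1 - q) ^+ N ->
  N%:R * q <= 2 * (1 - (1 - q) ^+ N))%R.
Proof.
move=> /andP[q0 q1] h.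
have : ((1 - q) ^+ N * (1 + N%:R * q) <= 1)%R.
  elim: N {h} => [|N IH]; first by rewrite expr0 mul0r addr0 mulr1.
  apply: le_trans IH; rewrite exprSr -mulrA ler_wpM2l ?exprn_ge0 ?subr_ge0//.
  rewrite -natr1; have : (0 <= N%:R :> R)%R by []; move: (N%:R : R)%R => x x0; nra.
by move: ((1 - q) ^+ N)%R (N%:R * q)%R h (mulr_ge0 (ler0n R N) q0) => a b h b0; nra.
Qed.

Variable c : R.
Hypothesis c0 : (0 < c)%R.
Let tail x := P [set t | (x <= c * `|X (0%N, 0%N) t|)%R].

Let measurable_tail a x : measurable [set t | (x <= c * `|X a t|)%R].
Proof.
apply: measurable_set_ge; apply: measurable_funM => //; exact: measurableT_comp.
Qed.

Let tailE a x : P [set t | (x <= c * `|X a t|)%R] = tail x.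
Proof.
have mB : measurable [set r : R | (x <= c * `|r|)%R].
  by apply: measurable_set_ge; apply: measurable_funM => //; exact: measurableT_comp.
exact: (identX a (0%N, 0%N) mB).
Qed.

Let kap : R := fine (P [set t | (c <= `|X (0%N, 0%N) t|)%R]).

(** Entry [N] is reserved as the factor of modulus at least [c]: if also [c |X| >= x] for one of the
    [N] earlier entries, the product of the two reaches [x]. *)
Lemma tail_prod_exceeds N x :
  (kap * (1 - (1 - fine (tail x)) ^+ N))%:E <= P (prod_exceeds X (pair 0%N) N.+1 x).
Proof.
(* [E] asks entry [N] to be large and all earlier ones to be small, an intersection that [prob_box]
   evaluates; [B] minus [E] is the wanted event. *)
pose A i : set R := if (i < N)%N then ~` [set r | (x <= c * `|r|)%R]
  else [set r | (c <= `|r|)%R].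
have mB : measurable [set r : R | (c <= `|r|)%R].
  by apply: measurable_set_ge; exact: normr_measurable.
have mx : measurable [set r : R | (x <= c * `|r|)%R].
  by apply: measurable_set_ge; apply: measurable_funM => //; exact: normr_measurable.
have mA i : measurable (A i) by rewrite /A; case: ifP => // _; exact: measurableC.
pose E := \bigcap_(i < N.+1) X (0%N, i) @^-1` A i.
pose B := X (0%N, N) @^-1` [set r | (c <= `|r|)%R].
have mBX : measurable B by exact: measurable_preimage.
have mE : measurable E.
  by apply: bigcap_measurable => [|i _]; [exists 0%N|exact: measurable_preimage].
have PB : P B = kap%:E.
  rewrite /kap fineK; first exact: (identX (0%N, N) (0%N, 0%N) mB).
  exact: fin_num_measure (measurable_preimage (measurable_funP (X (0%N, 0%N))) mB).
have PE : P E = (((1 - fine (tail x)) ^+ N) * kap)%:E.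
  rewrite /E (prob_box indepX identX (phi := pair 0%N))//; last by move=> ? ? _ _ [].
  rewrite big_ord_recr /= {2}/A ltnn -[X in _ * X](identX (0%N, N) _ mB) PB EFinM.
  congr (_ * _); rewrite (eq_bigr (fun=> (1 - fine (tail x))%:E)).
    by rewrite prodEFin prodr_const card_ord.
  move=> i _; rewrite /A ltn_ord preimage_setC.
  have mt := measurable_preimage (measurable_funP (X (0%N, 0%N))) mx.
  by rewrite (probability_setC P mt) EFinB fineK// (fin_num_measure P _ mt).
have EB : E `<=` B by move=> t /(_ N (ltnSn N)); rewrite /A /= ltnn.
have BE : B `\` E `<=` prod_exceeds X (pair 0%N) N.+1 x.
  move=> t [Bt /existsNP[i /not_implyP[]]]; rewrite /= ltnS /A leq_eqVlt.
  move=> /orP[/eqP->|iN]; first by rewrite ltnn.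
  rewrite iN => /contrapT /= h; exists i, N; split => //; rewrite normrM.
  by apply: (le_trans h); rewrite mulrC ler_wpM2l.
apply: (@le_trans _ _ (P (B `\` E))); last first.
  apply: le_measure; rewrite ?inE//; first exact: measurableD.
  exact: measurable_prod_exceeds.
have -> : P (B `\` E) = P B - P E.
  rewrite -[in RHS](setIidr EB); apply: measureD => //.
  exact: (le_lt_trans (probability_le1 P mBX) (ltry _)).
by rewrite PB PE -EFinB lee_fin mulrBr mulr1 mulrC.
Qed.

Variable al : R.
Hypothesis al0 : (0 < al)%R.
Hypothesis sumX :
  \sum_(n <oo) P (prod_exceeds X (pair 0%N) n (n%:R `^ al)%R) < +oo.
Hypothesis kap0 : (0 < kap)%R.

Lemma tail_series_lty : \sum_(n <oo) n%:R%:E * tail (n%:R `^ al)%R < +oo.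
Proof.
pose a n := P (prod_exceeds X (pair 0%N) n (n%:R `^ al)%R).
have a0 n : 0 <= a n by [].
have [|N hN] := @small_terms a (kap / 2)%R a0 sumX; first by rewrite divr_gt0.
have afin n : a n \is a fin_num by rewrite fin_num_measure//; exact: measurable_prod_exceeds.
have tfin x : tail x \is a fin_num by rewrite fin_num_measure//; exact: measurable_tail.
(* From [N.+2] on, [a n <= kap / 2] allows the union bound to be reversed. The terms [r n] absorb
   the finitely many earlier indices, for which [n (n + 1) (n + 2) <= (N + 4)^3]. *)
pose C : R := (N.+4%:R ^+ 3)%R.
pose r n : R := (C * (n.+1%:R * n.+2%:R)^-1)%R.
have r0 n : (0 <= r n)%R by rewrite mulr_ge0 ?exprn_ge0 ?invr_ge0 ?mulr_ge0.
apply: (@le_lt_trans _ _ (\sum_(n <oo) ((4 / kap)%:E * a n + (r n)%:E))); last first.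
  have s0 n : 0 <= (4 / kap)%:E * a n by rewrite mule_ge0// lee_fin divr_ge0// ltW.
  rewrite nneseriesD//; last by move=> n _ _; rewrite lee_fin.
  rewrite nneseriesZl//; apply: lte_add_pinfty.
    by apply: lte_mul_pinfty => //; rewrite lee_fin divr_ge0// ltW.
  by apply: (@nneseries_telescope_lty _ _ C) => // n; rewrite lee_fin.
apply: lee_nneseries => [n _ _|n _]; first by rewrite mule_ge0.
rewrite -(fineK (tfin _)) -(fineK (afin n)) -!EFinM -EFinD lee_fin.
have t01 : (0 <= fine (tail (n%:R `^ al)%R) <= 1)%R.
  by rewrite fine_ge0//= -lee_fin fineK// probability_le1//; exact: measurable_tail.
have [nN|Nn] := ltnP n N.+2.
  have h1 : (0 <= 4 / kap * fine (a n))%R by rewrite mulr_ge0 ?fine_ge0// divr_ge0// ltW.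
  rewrite -[leLHS]add0r; apply: lerD => //.
  case/andP: t01 => t0 t1; apply: (@le_trans _ _ n%:R%R); first by rewrite ler_piMr.
  rewrite /r ler_pdivlMr ?mulr_gt0// /C exprS expr2.
  apply: ler_pM => //; first by rewrite ler_nat; lia.
  by apply: ler_pM => //; rewrite ler_nat; lia.
case: n Nn t01 => // n Nn t01; set q := fine (tail _) in t01 *.
have Nn' : (N <= n.+1)%N by lia.
have n1 : (1 <= n%:R :> R)%R by rewrite ler1n; lia.
have h1 : (kap * (1 - (1 - q) ^+ n) <= fine (a n.+1))%R.
  by rewrite -lee_fin fineK//; exact: tail_prod_exceeds.
have h2 : (fine (a n.+1) <= kap / 2)%R by rewrite -lee_fin fineK//; exact: hN.
have h3 : (1 - (1 - q) ^+ n <= fine (a n.+1) / kap)%R by rewrite ler_pdivlMr// mulrC.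
have h4 : (fine (a n.+1) / kap <= 1 / 2)%R by rewrite ler_pdivrMr//; lra.
have h5 : (1 / 2 <= (1 - q) ^+ n)%R by lra.
have h6 := geometric_union_bound t01 h5.
rewrite -[leLHS]addr0; apply: lerD => //.
have -> : (4 / kap * fine (a n.+1) = 4 * (fine (a n.+1) / kap))%R by ring.
case/andP: t01 => t0 _.
(* [tail_prod_exceeds] spends one entry on the factor [c], so only [n] of the [n.+1] entries are
   counted; [n >= 1] recovers this at the cost of a factor 2. *)
have : (n.+1%:R * q <= 2 * (n%:R * q))%R.
  by rewrite mulrA ler_wpM2r// -natr1; lra.
lra.
Qed.

(** The union bound runs over [O(n^2)] entries. At scale [2^m] one factor [2^m] is the weight of the
    condensation, the other comes from the factor [n] in [tail_series_lty]. *)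
Lemma singles_ae_small (K : nat) (dl : R) : (0 < dl)%R ->
  {ae P, forall t, exists N, forall n, (N <= n)%N -> forall k i,
    (k < n)%N -> (i < K * n)%N -> (c * `|X (k, i) t| < dl * n%:R `^ al)%R}.
Proof.
move=> dl0.
pose bad n x : set T := \bigcup_(k < n) \bigcup_(i < (K * n)%N)
  [set t | (x <= c * `|X (k, i) t|)%R].
have mbad n x : measurable (bad n x).
  by do 2 apply: bigcup_measurable => ? _; exact: measurable_tail.
have bad_mono m n x y : (m <= n)%N -> (y <= x)%R -> bad m x `<=` bad n y.
  move=> mn yx t [k /= km [i /= im h]]; exists k; first exact: leq_trans mn.
  exists i; last exact: le_trans h.
  by rewrite /= (leq_trans im)// leq_mul2l mn orbT.
have sbad l : \sum_(m <oo) P (bad (2 ^ (m + l).+1)%N ((2 ^ m.+2)%:R `^ al)%R) < +oo.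
  pose b m := (2 ^ m.+1)%:R%:E * tail ((2 ^ m.+2)%:R `^ al)%R.
  have sb : \sum_(m <oo) (2 ^ m)%:R%:E * b m < +oo.
    apply: (dyadic_series_lty _ _ tail_series_lty) => [n|m n /andP[mn nm]|m].
    - by rewrite mule_ge0.
    - apply: lee_pmul => //; first by rewrite lee_fin ler_nat.
      apply: le_measure; rewrite ?inE; try exact: measurable_tail.
      move=> t /=; apply: le_trans.
      by apply: ge0_ler_powR; rewrite ?nnegrE ?ler_nat//; [exact: ltW|exact: ltnW].
    - by rewrite mule_ge0.
  pose C : R := ((2 ^ l.+1)%:R * (K%:R * (2 ^ l)%:R))%R.
  apply: (@le_lt_trans _ _ (\sum_(m <oo) C%:E * ((2 ^ m)%:R%:E * b m))).
    apply: lee_nneseries => // m _.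
    pose t := fine (tail ((2 ^ m.+2)%:R `^ al)%R).
    have tE : tail ((2 ^ m.+2)%:R `^ al)%R = t%:E.
      by rewrite fineK// fin_num_measure//; exact: measurable_tail.
    apply: le_trans (@Boole_bigcup_le _ _ _ P _ _ ((K * 2 ^ (m + l).+1)%:R * t)%R _ _) _.
    - by move=> k; apply: bigcup_measurable => i _; exact: measurable_tail.
    - move=> k _; apply: Boole_bigcup_le => [i|i _]; first exact: measurable_tail.
      by rewrite tailE tE.
    rewrite /b tE -!EFinM lee_fin /C le_eqVlt; apply/orP; left; apply/eqP.
    rewrite -addnS !natrM !natrX !exprD !exprS; ring.
  rewrite nneseriesZl//; last by move=> m _; rewrite !mule_ge0.
  by apply: lte_mul_pinfty => //; rewrite lee_fin !mulr_ge0.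
have := dyadic_ae al0 dl0 mbad bad_mono sbad.
apply: filterS => t [N hN]; exists N => n Nn k i kn iK.
rewrite ltNge; apply/negP => h; apply: (hN n Nn).
by exists k => //; exists i.
Qed.

End tails.

(** * The second moment *)

Section second_moment.
Context d (T : measurableType d) (R : realType) (P : probability T R)
  (Y : {RV P >-> R}).
Local Open Scope ereal_scope.

(** Take the least [k] with [y < (k + 1)^al]. The indices up to [k] contribute [k (k + 1) / 2],
    while [al <= 1] gives [y <= k + 1], and [(k + 1)^2 <= 1 + 2 k (k + 1)]. *)
Lemma sqr_le_series (al y : R) : (0 < al <= 1)%R -> (0 <= y)%R ->
  (y ^+ 2)%:E <= 1 +
    4%:E * \sum_(n <oo) (n%:R * (nat_of_bool (n%:R `^ al <= y)%R)%:R)%R%:E.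
Proof.
move=> /andP[al0 al1] y0.
have ex : exists k, (y < k.+1%:R `^ al)%R.
  have [l hl] := powR_nat_unbounded (y + 1)%R al0.
  exists (2 ^ l).-1; rewrite prednK ?expn_gt0//; apply: lt_le_trans hl.
  by rewrite ltrDl.
case: (ex_minnP ex) => k yk kmin.
have kal : (0 < k)%N -> (k%:R `^ al <= y)%R.
  move=> k0; rewrite leNgt; apply/negP => yk'.
  by have := kmin k.-1; rewrite prednK// => /(_ yk'); lia.
have gauss : (4 * \sum_(0 <= n < k.+1) n%:R = 2 * (k%:R * (k%:R + 1)) :> R)%R.
  elim: (k) => [|j IH]; first by rewrite big_nat1 mul0r !mulr0.
  by rewrite big_nat_recr//= mulrDr IH -natr1; ring.
have yk1 : (y <= k%:R + 1)%R.
  apply: (le_trans (ltW yk)); rewrite natr1 -[leRHS]powRr1//.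
  by rewrite ler_powR// ler1n.
have yk2 : (y ^+ 2 <= 1 + 4 * \sum_(0 <= n < k.+1) n%:R)%R.
  rewrite gauss; apply: (@le_trans _ _ ((k%:R + 1) ^+ 2)%R).
    by rewrite ler_sqr ?nnegrE// addr_ge0.
  by have : (0 <= k%:R :> R)%R by []; move: (k%:R : R)%R => x x0; nra.
apply: (@le_trans _ _ (1 + 4 * \sum_(0 <= n < k.+1) n%:R)%R%:E); first by rewrite lee_fin.
rewrite EFinD EFinM leeD// lee_wpmul2l// -sumEFin.
apply: (@le_trans _ _ (\sum_(0 <= n < k.+1)
    (n%:R * (nat_of_bool (n%:R `^ al <= y)%R)%:R)%R%:E)).
  rewrite !big_nat; apply: lee_sum => n /= nk; rewrite lee_fin.
  have [->|n0] := posnP n; first by rewrite mul0r.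
  suff -> : (n%:R `^ al <= y)%R by rewrite mulr1.
  apply: le_trans (kal _); last by lia.
  by apply: ge0_ler_powR; rewrite ?nnegrE ?ler_nat//; exact: ltW.
by apply: nneseries_lim_ge => n _ _; rewrite lee_fin mulr_ge0.
Qed.

Lemma second_moment_lty (c al : R) : (0 < c)%R -> (0 < al <= 1)%R ->
  \sum_(n <oo) n%:R%:E * P [set t | (n%:R `^ al <= c * `|Y t|)%R] < +oo ->
  \int[P]_t (Y t ^+ 2)%:E < +oo.
Proof.
move=> c0 hal sY.
pose A n : set T := [set t | (n%:R `^ al <= c * `|Y t|)%R].
have mcY : measurable_fun setT (fun t => c * `|Y t|)%R.
  by apply: measurable_funM => //; exact: measurableT_comp.
have mA n : measurable (A n) by exact: measurable_set_ge.
have mind n : measurable_fun setT (fun t => (n%:R * \1_(A n) t)%:E : \bar R).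
  by apply/measurable_EFinP; apply: measurable_funM => //; exact: measurable_indic.
have ind0 n t : 0 <= (n%:R * \1_(A n) t)%:E :> \bar R by rewrite lee_fin mulr_ge0.
have mser : measurable_fun setT (fun t => \sum_(n <oo) (n%:R * \1_(A n) t)%:E : \bar R).
  exact: ge0_emeasurable_sum.
have ser0 t : 0 <= \sum_(n <oo) (n%:R * \1_(A n) t)%:E :> \bar R by exact: nneseries_ge0.
have le1 : \int[P]_t ((c * `|Y t|) ^+ 2)%:E <=
    \int[P]_t (1 + 4%:E * \sum_(n <oo) (n%:R * \1_(A n) t)%:E).
  apply: ge0_le_integral => //.
  - by move=> t _; rewrite lee_fin sqr_ge0.
  - by apply/measurable_EFinP; exact: (measurable_funX 2 mcY).
  - by apply: emeasurable_funD => //; exact: emeasurable_funM.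
  - move=> t _; apply: le_trans (sqr_le_series hal _) _; first by rewrite mulr_ge0// ltW.
    rewrite le_eqVlt; apply/orP; left; apply/eqP; congr (_ + _ * _).
    apply: eq_eseriesr => n _; congr (_ * _)%:E.
    by rewrite indicE; congr (nat_of_bool _)%:R; apply/idP/idP; rewrite inE.
have lt1 : \int[P]_t (1 + 4%:E * \sum_(n <oo) (n%:R * \1_(A n) t)%:E) < +oo.
  rewrite ge0_integralD//; last 2 first.
  - by move=> t _; rewrite mule_ge0.
  - exact: emeasurable_funM.
  rewrite integral_cst// mul1e ge0_integralZl// integral_nneseries//.
  apply: lte_add_pinfty; first by rewrite (le_lt_trans (probability_le1 _ _))// ltry.
  apply: lte_mul_pinfty => //.
  rewrite (eq_eseriesr (g := fun n => n%:R%:E * P (A n)))// => n _.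
  under eq_integral do rewrite EFinM.
  by rewrite ge0_integralZl// ?integral_indic ?setIT//; exact/measurable_EFinP/measurable_indic.
have := le_lt_trans le1 lt1.
rewrite (_ : (fun t => _) = fun t => (c ^+ 2)%:E * (Y t ^+ 2)%:E); last first.
  by apply/funext => t; rewrite exprMn real_normK ?num_real.
rewrite ge0_integralZl//; last 3 first.
- by apply/measurable_EFinP; exact: measurable_funX.
- by move=> t _; rewrite lee_fin sqr_ge0.
- by rewrite lee_fin sqr_ge0.
have : 0 <= \int[P]_t (Y t ^+ 2)%:E by apply: integral_ge0 => t _; rewrite lee_fin sqr_ge0.
case: (\int[P]_t (Y t ^+ 2)%:E) => [r _ _||//]; first exact: ltry.
by rewrite gt0_muley ?lte_fin ?exprn_gt0.
Qed.

End second_moment.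

(** * A deterministic bound for correlations *)

Section correlation_bound.
Context (R : realType).
Implicit Types (u v : nat -> R) (x : nat -> nat -> R).

Lemma sum_subM n u v a b : \sum_(k < n) (u k - a) * (v k - b) =
  \sum_(k < n) u k * v k - b * \sum_(k < n) u k - a * \sum_(k < n) v k + n%:R * a * b.
Proof.
rewrite !mulr_sumr -!sumrB (_ : n%:R * a * b = \sum_(k < n) a * b); last first.
  by rewrite sumr_const card_ord -mulrA mulr_natl.
by rewrite -big_split; apply: eq_bigr => k _ /=; ring.
Qed.

Lemma sum_subr n u a : \sum_(k < n) (u k - a) = \sum_(k < n) u k - n%:R * a.
Proof. by rewrite sumrB sumr_const card_ord mulr_natl. Qed.

Lemma sum_mean_subM n u v a b : (0 < n)%N ->
  \sum_(k < n) (u k - n%:R^-1 * \sum_(k < n) u k) * (v k - n%:R^-1 * \sum_(k < n) v k) =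
  \sum_(k < n) (u k - a) * (v k - b) -
    (\sum_(k < n) (u k - a)) * (\sum_(k < n) (v k - b)) / n%:R.
Proof.
move=> n0; rewrite !sum_subM !sum_subr.
have n0' : n%:R != 0 :> R by rewrite pnatr_eq0 -lt0n.
move: (\sum_(k < n) u k) (\sum_(k < n) v k) (\sum_(k < n) u k * v k) => U V W.
by field.
Qed.

(** The exponent [(1 + al) / 2] makes [S_i S_j / n] at most [e^2 n^al]. As [e <= w / 4], this
    correction removes at most [w n / 4] from a sum of squares, leaving [w n / 2], and at most
    doubles the bound [e n^al] of the numerator; the ratio is [4 e / w]. *)
Lemma pearson_bound x n i j (a al e w : R) : (0 < n)%N -> al <= 1 ->
  0 < w -> w <= 1 -> 0 < e -> e <= w / 4 ->
  `|\sum_(k < n) (x k i - a) * (x k j - a)| <= e * n%:R `^ al ->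
  (forall l, l \in [:: i; j] ->
    `|\sum_(k < n) (x k l - a)| <= e * n%:R `^ ((1 + al) / 2) /\
    3 / 4 * w * n%:R <= \sum_(k < n) (x k l - a) ^+ 2) ->
  n%:R `^ (1 - al) * `|pearson x n i j| <= 4 * e / w.
Proof.
move=> n0 al1 w0 w1 e0 ew hij hl.
have n0' : 0 < n%:R :> R by rewrite ltr0n.
have nne : n%:R != 0 :> R by rewrite gt_eqF.
have n1 : 1 <= n%:R :> R by rewrite ler1n.
set B := n%:R `^ al; set G := n%:R `^ ((1 + al) / 2).
have B0 : 0 < B by exact: powR_gt0.
have G0 : 0 < G by exact: powR_gt0.
have GG : G * G = n%:R * B.
  rewrite /G /B -powRD; last by rewrite nne implybT.
  by rewrite -[X in _ = X * _]powRr1// -powRD ?nne ?implybT//; congr (_ `^ _); field.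
have Bn : B <= n%:R by rewrite -[leRHS]powRr1// ler_powR.
have nB : n%:R `^ (1 - al) = n%:R / B.
  by rewrite powRB ?nne ?implybT// powRr1.
have SS l l' : l \in [:: i; j] -> l' \in [:: i; j] ->
    `|(\sum_(k < n) (x k l - a)) * (\sum_(k < n) (x k l' - a)) / n%:R| <= e ^+ 2 * B.
  move=> /hl[hl1 _] /hl[hl2 _]; rewrite normrM normrM.
  rewrite (gtr0_norm (_ : 0 < n%:R^-1)) ?invr_gt0//.
  rewrite ler_pdivrMr// (_ : e ^+ 2 * B * n%:R = (e * G) * (e * G)); last first.
    by rewrite mulrACA GG; ring.
  exact: ler_pM.
have V l : l \in [:: i; j] -> w * n%:R / 2 <= \sum_(k < n) (x k l - col_mean x n l) ^+ 2.
  move=> ll; have [_] := hl _ ll.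
  under eq_bigr do rewrite expr2.
  move=> h.
  under eq_bigr do rewrite expr2.
  rewrite (sum_mean_subM (fun k => x k l) (fun k => x k l) a a n0).
  have := SS _ _ ll ll; rewrite ler_norml => /andP[_].
  move: h (_ / n%:R) => + S; move: (\sum_(k < n) _) => Q hQ hS.
  have : e ^+ 2 * B <= e * n%:R.
    by rewrite expr2 -mulrA ler_wpM2l ?(ltW e0)//; nra.
  nra.
have num : `|\sum_(k < n) (x k i - col_mean x n i) * (x k j - col_mean x n j)| <= 2 * e * B.
  rewrite (sum_mean_subM (fun k => x k i) (fun k => x k j) a a n0).
  apply: (le_trans (ler_normB _ _)).
  have := SS i j; rewrite !inE !eqxx orbT => /(_ isT isT).
  move: hij; rewrite -/B; move: `|_| `|_| => s1 s2 h1 h2.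
  have : e ^+ 2 * B <= e * B by rewrite ler_wpM2r ?(ltW B0)//; nra.
  nra.
have den : w * n%:R / 2 <= Num.sqrt (\sum_(k < n) (x k i - col_mean x n i) ^+ 2) *
    Num.sqrt (\sum_(k < n) (x k j - col_mean x n j) ^+ 2).
  have wn0 : 0 <= w * n%:R / 2 by rewrite divr_ge0// mulr_ge0// ltW.
  rewrite -[leLHS]sqr_sqrtr// expr2.
  by apply: ler_pM; rewrite ?sqrtr_ge0// ler_sqrt; first [apply: V; rewrite !inE eqxx ?orbT|
    apply: le_trans wn0 (V _ _); rewrite !inE eqxx ?orbT].
have wn : 0 < w * n%:R / 2 by rewrite divr_gt0// mulr_gt0.
have den0 := lt_le_trans wn den.
rewrite /pearson normrM (gtr0_norm (_ : 0 < _^-1)) ?invr_gt0// nB.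
apply: (@le_trans _ _ (n%:R / B * (2 * e * B / (w * n%:R / 2)))).
  rewrite ler_pM2l ?divr_gt0//; apply: ler_pM => //.
  by rewrite lef_pV2 ?posrE.
rewrite le_eqVlt; apply/orP; left; apply/eqP; field.
by rewrite !gt_eqF.
Qed.

Lemma Lmax_bound x n p (r M : R) : 0 <= r -> 0 <= M ->
  (forall i j, (i < j)%N -> (j < p)%N -> r * `|pearson x n i j| <= M) ->
  0 <= r * Lmax x n p <= M.
Proof.
move=> r0 M0 h; have L0 : 0 <= Lmax x n p by exact: bigmax_ge_id.
rewrite mulr_ge0//=.
have [->|rn] := eqVneq r 0; first by rewrite mul0r.
have rp : 0 < r by rewrite lt_neqAle eq_sym rn.
rewrite -ler_pdivlMl// mulrC; apply: bigmax_le => [|j _]; first by rewrite divr_ge0.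
apply: bigmax_le => [|i _]; first by rewrite divr_ge0.
by rewrite ler_pdivlMr// mulrC; exact: h.
Qed.

End correlation_bound.

(** * Centered functions of the entries *)

Section centered_functions.
Context d (T : measurableType d) (R : realType) (P : probability T R)
  (X : nat * nat -> {RV P >-> R}).
Hypothesis indepX : mutually_independent X.
Hypothesis identX : identically_distributed X.
Local Open Scope ereal_scope.

Lemma centered_L2_single (h : R -> R) (s : R) : measurable_fun setT h ->
  P.-integrable setT (fun t => (h (X (0%N, 0%N) t))%:E) ->
  \int[P]_t (h (X (0%N, 0%N) t))%:E = 0 ->
  P.-integrable setT (fun t => (h (X (0%N, 0%N) t) ^+ 2)%:E) ->
  \int[P]_t (h (X (0%N, 0%N) t) ^+ 2)%:E = s%:E ->
  centered_L2 X (fun z => h z.1) s.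
Proof.
move=> mh ih h0 ih2 hs a b _ /=.
have mh2 : measurable_fun setT (fun x => h x ^+ 2)%R by exact: measurable_funX.
split.
- exact: (ident_integrable identX a mh ih).
- by rewrite -(ident_integral identX a mh ih).
- exact: (ident_integrable identX a mh2 ih2).
- by rewrite -(ident_integral identX a mh2 ih2) hs.
Qed.

Lemma centered_L2_prod (h : R -> R) (s : R) : measurable_fun setT h ->
  P.-integrable setT (fun t => (h (X (0%N, 0%N) t))%:E) ->
  \int[P]_t (h (X (0%N, 0%N) t))%:E = 0 ->
  P.-integrable setT (fun t => (h (X (0%N, 0%N) t) ^+ 2)%:E) ->
  \int[P]_t (h (X (0%N, 0%N) t) ^+ 2)%:E = s%:E ->
  centered_L2 X (fun z => h z.1 * h z.2)%R (s * s)%R.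
Proof.
move=> mh ih h0 ih2 hs a b ab /=.
have mh2 : measurable_fun setT (fun x => h x ^+ 2)%R by exact: measurable_funX.
have ih' c := ident_integrable identX c mh ih.
have ih2' c := ident_integrable identX c mh2 ih2.
have I1 := indep_fun_comp mh mh (indep_X indepX ab).
have I2 := indep_fun_comp mh2 mh2 (indep_X indepX ab).
split.
- exact: (indep_integrableM I1 (ih' a) (ih' b)).
- rewrite (indep_integralM I1 (ih' a) (ih' b)) /=.
  by rewrite -(ident_integral identX a mh ih) h0 mul0e.
- under eq_fun do rewrite exprMn.
  exact: (indep_integrableM I2 (ih2' a) (ih2' b)).
- under eq_integral do rewrite exprMn.
  rewrite (indep_integralM I2 (ih2' a) (ih2' b)) /=.
  by rewrite -(ident_integral identX a mh2 ih2) -(ident_integral identX b mh2 ih2) hs EFinM.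
Qed.

End centered_functions.

Section moments.
Context d (T : measurableType d) (R : realType) (P : probability T R)
  (Y : {RV P >-> R}).
Local Open Scope ereal_scope.

Lemma integrable_cst (r : R) : P.-integrable setT (fun=> r%:E).
Proof. exact: finite_measure_integrable_cst. Qed.

Lemma integrable_sqr : \int[P]_t (Y t ^+ 2)%:E < +oo ->
  P.-integrable setT (fun t => (Y t ^+ 2)%:E).
Proof.
move=> Y2; apply/integrableP; split.
  by apply/measurable_EFinP; exact: measurable_funX.
by under eq_integral do rewrite gee0_abs ?lee_fin ?sqr_ge0//.
Qed.

Lemma integrable_of_sqr : \int[P]_t (Y t ^+ 2)%:E < +oo ->
  P.-integrable setT (fun t => (Y t)%:E).
Proof.
move=> /integrable_sqr Y2.
apply: (le_integrable measurableT _ _ (integrableD measurableT (integrable_cst 1) Y2)).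
  exact/measurable_EFinP.
move=> t _ /=; rewrite lee_fin [leRHS]ger0_norm ?addr_ge0 ?sqr_ge0//.
rewrite -(real_normK (num_real (Y t))); move: `|Y t|%R => y; nra.
Qed.

Lemma integrable_sqr_shift (m : R) : \int[P]_t (Y t ^+ 2)%:E < +oo ->
  P.-integrable setT (fun t => ((Y t - m) ^+ 2)%:E).
Proof.
move=> Y2; have i2 := integrable_sqr Y2.
have iD := integrableD measurableT (integrable_cst (2 * m ^+ 2))
  (integrableZl measurableT 2 i2).
apply: (le_integrable measurableT _ _ iD).
  apply/measurable_EFinP; apply: (@measurable_funX _ _ _ _ (fun t => Y t - m)%R).
  exact: measurable_funB.
move=> t _ /=; rewrite lee_fin [leLHS]ger0_norm ?sqr_ge0//.
apply: le_trans (ler_norm _).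
have := sqr_ge0 (Y t + m)%R; move: (Y t) => y; nra.
Qed.

Lemma integral_center (m : R) : P.-integrable setT (fun t => (Y t)%:E) ->
  \int[P]_t (Y t)%:E = m%:E -> \int[P]_t (Y t - m)%:E = 0.
Proof.
move=> iY Ym; have := integralB measurableT iY (integrable_cst m).
rewrite Ym integral_cst//= probability_setT mule1 subee//.
Qed.

End moments.

Section truncated_square.
Context d (T : measurableType d) (R : realType) (P : probability T R)
  (Y : {RV P >-> R}).
Hypothesis ndY : nondegenerate_rv Y.
Local Open Scope ereal_scope.

(** Capping at 1 gives a bounded variable, to which the tail estimate applies without a fourth
    moment of [Y]. A zero mean would force [Y = m] almost surely. *)
Lemma min_sqr_moment (m : R) : exists2 w, (0 < w <= 1)%R &
  \int[P]_t (Num.min ((Y t - m) ^+ 2) 1)%:E = w%:E.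
Proof.
have mW : measurable_fun setT (fun t => Num.min ((Y t - m) ^+ 2) 1)%R.
  apply: measurable_minr => //; apply: (@measurable_funX _ _ _ _ (fun t => Y t - m)%R).
  exact: measurable_funB.
have W0 t : 0 <= (Num.min ((Y t - m) ^+ 2) 1)%:E :> \bar R.
  by rewrite lee_fin le_min sqr_ge0/=.
set J := \int[P]_t _.
have J0 : 0 <= J by exact: integral_ge0.
have J1 : J <= 1.
  apply: (@le_trans _ _ (\int[P]_t 1)).
    apply: ge0_le_integral => //; first exact/measurable_EFinP.
    by move=> t _; rewrite lee_fin ge_min lexx orbT.
  by rewrite integral_cst// mul1e probability_le1.
have Jfin : J \is a fin_num by rewrite ge0_fin_numE// (le_lt_trans J1)// ltry.
exists (fine J); last by rewrite fineK.
rewrite -!lee_fin -lte_fin fineK// J1 andbT lt0e J0 andbT; apply/eqP => I00.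
apply: (nondegenerate_not_ae ndY (c := m)).
have /ae_eq_integral_abs : \int[P]_t `|(Num.min ((Y t - m) ^+ 2) 1)%:E| = 0.
  by under eq_integral do rewrite gee0_abs//.
have mEW : measurable_fun setT (fun t => (Num.min ((Y t - m) ^+ 2) 1)%:E : \bar R).
  exact/measurable_EFinP.
move=> /(_ measurableT mEW); apply: filterS => t /(_ I) /= [] /eqP.
rewrite /Order.min; case: ifP => _; last by rewrite oner_eq0.
by rewrite sqrf_eq0 subr_eq0 => /eqP.
Qed.

End truncated_square.

(** * The largest correlation *)

Lemma powR_eventually (R : realType) (b M : R) : 0 < b ->
  exists N, forall n, (N <= n)%N -> (0 < n)%N /\ M <= n%:R `^ b.
Proof.
move=> b0; have [l hl] := powR_nat_unbounded M b0.
exists (2 ^ l)%N => n ln; split; first by rewrite (leq_trans _ ln)// expn_gt0.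
apply: (le_trans hl); apply: ge0_ler_powR; rewrite ?nnegrE ?ler_nat//; exact: ltW.
Qed.

Lemma trunc_sum_id (R : realType) (y : R) n (v : nat -> R) :
  (forall k, (k < n)%N -> `|v k| <= y) -> \sum_(k < n) trunc y (v k) = \sum_(k < n) v k.
Proof. by move=> h; apply: eq_bigr => k _; rewrite trunc_id// h. Qed.

Section largest_entry.
Context d (T : measurableType d) (R : realType) (P : probability T R)
  (X : nat * nat -> {RV P >-> R}).
Hypothesis indepX : mutually_independent X.
Hypothesis identX : identically_distributed X.
Hypothesis ndX : nondegenerate_rv (X (0%N, 0%N)).
Variables (al : R) (K : nat) (p : nat -> nat).
Hypothesis al12 : 1 / 2 < al.
Hypothesis al1 : al <= 1.
Hypothesis pK : forall n, (0 < n)%N -> (p n <= K * n)%N.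
Hypothesis sumX :
  (\sum_(n <oo) P (prod_exceeds X (pair 0%N) n (n%:R `^ al)%R) < +oo)%E.

Let al0 : 0 < al. Proof. by move: al12; lra. Qed.

Let tail_gt0 : exists2 c : R, 0 < c & 0 < fine (P [set t | (c <= `|X (0%N, 0%N) t|)%R]).
Proof.
have [c c0 kap0] := nondegenerate_tail ndX.
exists c => //; apply: fine_gt0; rewrite kap0 (le_lt_trans (probability_le1 _ _)) ?ltry//.
by apply: measurable_set_ge; apply: measurableT_comp.
Qed.

Lemma entries_ae_small (dl : R) : 0 < dl ->
  {ae P, forall t, exists N, forall n, (N <= n)%N -> forall k i,
    (k < n)%N -> (i < K * n)%N -> `|X (k, i) t| < dl * n%:R `^ al}.
Proof.
move=> dl0; have [c c0 kap0] := tail_gt0.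
have := singles_ae_small indepX identX c0 al0 sumX kap0 K (mulr_gt0 c0 dl0).
apply: filterS => t [N hN]; exists N => n Nn k i kn iK.
by have := hN n Nn k i kn iK; rewrite -mulrA ltr_pM2l.
Qed.

Lemma entry_second_moment : (\int[P]_t (X (0%N, 0%N) t ^+ 2)%:E < +oo)%E.
Proof.
have [c c0 kap0] := tail_gt0.
apply: (second_moment_lty c0 (al := al)); first by rewrite al0.
exact: (tail_series_lty indepX identX c0 al0 sumX kap0).
Qed.

(** [w] is chosen before [e], so that the bound tends to 0 with [e]. *)
Lemma normalized_Lmax_small : exists2 w : R, 0 < w & forall e, 0 < e -> e <= w / 4 ->
  {ae P, forall t, exists N, forall n, (N <= n)%N ->
    0 <= n%:R `^ (1 - al) * Lmax (fun k i => X (k, i) t) n (p n) <= 4 * e / w}.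
Proof.
have Y2 := entry_second_moment.
have iY := integrable_of_sqr Y2.
pose m := fine (\int[P]_t (X (0%N, 0%N) t)%:E)%E.
have Ym : (\int[P]_t (X (0%N, 0%N) t)%:E = m%:E)%E by rewrite fineK// integrable_fin_num.
have [w /andP[w0 w1] hw] := min_sqr_moment ndX m.
exists w => // e e0 ew.
have mh1 : measurable_fun [set: R] (fun x : R => x - m) by exact: measurable_funB.
have i1 : P.-integrable setT (fun t => (X (0%N, 0%N) t - m)%:E).
  have := integrableB measurableT iY (integrable_cst P m).
  by apply: eq_integrable => // t _; rewrite /= EFinB.
have z1 := integral_center iY Ym.
have i2 := integrable_sqr_shift m Y2.
pose s := fine (\int[P]_t ((X (0%N, 0%N) t - m) ^+ 2)%:E)%E.
have hs : (\int[P]_t ((X (0%N, 0%N) t - m) ^+ 2)%:E = s%:E)%E.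
  by rewrite fineK// integrable_fin_num.
have s0 : 0 <= s by rewrite fine_ge0// integral_ge0// => t _; rewrite lee_fin sqr_ge0.
have C1 := centered_L2_prod indepX identX mh1 i1 z1 i2 hs.
have C2 := centered_L2_single identX mh1 i1 z1 i2 hs.
have mh3 : measurable_fun [set: R] (fun x : R => Num.min ((x - m) ^+ 2) 1 - w).
  apply: measurable_funB => //; apply: measurable_minr => //.
  exact: (measurable_funX 2 mh1).
have h3le (x : R) : `|Num.min ((x - m) ^+ 2) 1 - w| <= 1.
  have : 0 <= Num.min ((x - m) ^+ 2) 1 by rewrite le_min sqr_ge0/=.
  have : Num.min ((x - m) ^+ 2) 1 <= 1 by rewrite ge_min lexx orbT.
  by move: (Num.min _ _) => z z1' z0; rewrite ler_norml; apply/andP; split; lra.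
have bounded_int (f : T -> R) : measurable_fun setT f -> (forall t, `|f t| <= 1) ->
    P.-integrable setT (EFin \o f).
  move=> mf f1; apply: (le_integrable measurableT _ _ (integrable_cst P 1)).
    exact/measurable_EFinP.
  by move=> t _; rewrite lee_fin /= normr1.
have mW : measurable_fun setT (fun t => Num.min ((X (0%N, 0%N) t - m) ^+ 2) 1 - w).
  by apply: (measurableT_comp mh3); exact: measurable_funP.
have i3 : P.-integrable setT (fun t => (Num.min ((X (0%N, 0%N) t - m) ^+ 2) 1 - w)%:E).
  exact: (bounded_int _ mW (fun t => h3le _)).
have i4 : P.-integrable setT
    (fun t => ((Num.min ((X (0%N, 0%N) t - m) ^+ 2) 1 - w) ^+ 2)%:E).
  have h4 t : `|(Num.min ((X (0%N, 0%N) t - m) ^+ 2) 1 - w) ^+ 2| <= 1.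
    by rewrite normrX exprn_ile1// h3le.
  exact: (bounded_int _ (measurable_funX 2 mW) h4).
have z3 : (\int[P]_t (Num.min ((X (0%N, 0%N) t - m) ^+ 2) 1 - w)%:E = 0)%E.
  have iM : P.-integrable setT (fun t => (Num.min ((X (0%N, 0%N) t - m) ^+ 2) 1)%:E).
    have := integrableD measurableT i3 (integrable_cst P w).
    by apply: eq_integrable => // t _; rewrite /= -EFinD subrK.
  have := integralB measurableT iM (integrable_cst P w).
  by rewrite hw integral_cst//= probability_setT mule1 subee.
pose s3 := fine (\int[P]_t ((Num.min ((X (0%N, 0%N) t - m) ^+ 2) 1 - w) ^+ 2)%:E)%E.
have hs3 : (\int[P]_t ((Num.min ((X (0%N, 0%N) t - m) ^+ 2) 1 - w) ^+ 2)%:E = s3%:E)%E.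
  by rewrite fineK// integrable_fin_num.
have s30 : 0 <= s3 by rewrite fine_ge0// integral_ge0// => t _; rewrite lee_fin sqr_ge0.
have C3 := centered_L2_single identX mh3 i3 z3 i4 hs3.
have mfst (h : R -> R) : measurable_fun setT h ->
    measurable_fun [set: R * R] (fun z : R * R => h z.1).
  by move=> mh; exact: (measurableT_comp mh (@measurable_fst _ _ R R)).
have mh11 : measurable_fun [set: R * R] (fun z : R * R => (z.1 - m) * (z.2 - m)).
  apply: measurable_funM; first exact: (mfst _ mh1).
  exact: (measurableT_comp mh1 (@measurable_snd _ _ R R)).
pose b2 := (1 + al) / 2.
have b20 : 0 < b2 by rewrite /b2; move: al0; lra.
have b2h : 1 / 2 < b2 by rewrite /b2; move: al0; lra.
(* The three families: products at exponent [al], single entries at [(1 + al) / 2], capped squares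
   at exponent 1. In the last, the error [w / 4] leaves three quarters of the mean [w]. *)
have [dl1 dl10 A1] := trunc_sums_ae_small indepX mh11 C1 K al12 e0 (mulr_ge0 s0 s0).
have [dl2 dl20 A2] := trunc_sums_ae_small indepX (mfst _ mh1) C2 K b2h e0 s0.
have w40 : 0 < w / 4 by rewrite divr_gt0.
have one_half : 1 / 2 < 1 :> R by lra.
have [dl3 dl30 A3] := trunc_sums_ae_small indepX (mfst _ mh3) C3 K one_half w40 s30.
have dl14 : 0 < dl1 / 4 by rewrite divr_gt0.
have A4 := products_ae_small indepX identX al0 sumX K dl14.
(* In [x y - m x - m y + m^2] the four terms receive the shares [dl1 / 4], [dl1 / 8], [dl1 / 8] and
   [dl1 / 4], in total below [dl1]; in [x - m] the entry receives [dl2 / 2]. The [+ 1] covers the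
   case [m = 0]. *)
pose dls := Num.min (dl1 / (8 * (`|m| + 1))) (dl2 / 2).
have dls0 : 0 < dls by rewrite lt_min !divr_gt0// mulr_gt0// ltr_wpDl.
have A5 := entries_ae_small dls0.
have dls1 : `|m| * dls <= dl1 / 8.
  have m1 : 0 < `|m| + 1 by rewrite ltr_wpDl.
  have : dls <= dl1 / (8 * (`|m| + 1)) by rewrite ge_min lexx.
  rewrite ler_pdivlMr ?mulr_gt0//; move: (normr_ge0 m) dls0; nra.
have dls2 : dls <= dl2 / 2 by rewrite ge_min lexx orbT.
(* Thresholds beyond which the constants fit: [m^2] into [dl1 / 4 * n^al], [|m|] into
   [dl2 / 2 * n^b2], and the bound 1 of the capped squares into [dl3 * n]. *)
have [N6 H6] := powR_eventually (4 * m ^+ 2 / dl1) al0.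
have [N7 H7] := powR_eventually (2 * `|m| / dl2) b20.
have [N8 H8] := powR_eventually (1 / dl3) (ltr01 : 0 < 1 :> R).
apply: filter_app3 A1 A2 A3; apply: filterS2 A4 A5 => t.
move=> [N4 H4] [N5 H5] [N1 H1] [N2 H2] [N3 H3].
exists (maxn N1 (maxn N2 (maxn N3 (maxn N4 (maxn N5 (maxn N6 (maxn N7 N8))))))) => n.
rewrite !geq_max => /and5P[n1 n2 n3 n4 /and4P[n5 n6 n7 n8]].
have [n0 {}H6] := H6 n n6; have [_ {}H7] := H7 n n7; have [_ {}H8] := H8 n n8.
have r0 : 0 <= n%:R `^ (1 - al) :> R by exact: powR_ge0.
have B1 : n%:R `^ al <= n%:R `^ b2 :> R.
  by rewrite ler_powR ?ler1n// /b2; move: al1; lra.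
have small k l : (k < n)%N -> (l < K * n)%N -> `|X (k, l) t| <= dls * n%:R `^ al.
  by move=> kn lK; rewrite ltW// H5.
apply: Lmax_bound => // [|i j ij jp].
  by rewrite divr_ge0 ?mulr_ge0 ?ltW.
have jK : (j < K * n)%N := leq_trans jp (pK n0).
have iK : (i < K * n)%N := ltn_trans ij jK.
have ij' : i != j by rewrite ltn_eqF.
apply: (pearson_bound (a := m)) => //.
- have := H1 n n1 i j iK jK ij' => /=.
  rewrite (trunc_sum_id (v := fun k => (X (k, i) t - m) * (X (k, j) t - m))).
    exact: ltW.
  move=> k kn; have hp := ltW (H4 n n4 k i j kn ij jK).
  have hi := small k i kn iK; have hj := small k j kn jK.
  move: hp hi hj H6; move: (X (k, i) t) (X (k, j) t) => x y hp hi hj.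
  rewrite ler_pdivrMr// => hm.
  have hmz z : `|z| <= dls * n%:R `^ al -> `|m * z| <= dl1 / 8 * n%:R `^ al.
    move=> hz; rewrite normrM; apply: (@le_trans _ _ (`|m| * (dls * n%:R `^ al))).
      by rewrite ler_wpM2l.
    by rewrite mulrA ler_wpM2r ?powR_ge0.
  have -> : (x - m) * (y - m) = x * y - m * x - m * y + m ^+ 2 by ring.
  have h1 := hmz _ hi; have h2 := hmz _ hj.
  have := ler_normD (x * y - m * x - m * y) (m ^+ 2).
  have := ler_normB (x * y - m * x) (m * y); have := ler_normB (x * y) (m * x).
  have := mulr_ge0 (ltW dl10) (powR_ge0 (n%:R : R) al).
  rewrite (ger0_norm (sqr_ge0 m)); lra.
(* The estimates [A2] and [A3] are indexed by pairs of distinct columns although they concern one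
   column only; [l'] is a companion, and each of [i], [j] serves the other. *)
- have main l l' : (l < K * n)%N -> (l' < K * n)%N -> l != l' ->
      `|\sum_(k < n) (X (k : nat, l) t - m)| <= e * n%:R `^ ((1 + al) / 2) /\
      3 / 4 * w * n%:R <= \sum_(k < n) (X (k : nat, l) t - m) ^+ 2.
    move=> lK l'K ll'; split.
      have := H2 n n2 l l' lK l'K ll' => /=.
      rewrite (trunc_sum_id (v := fun k => X (k, l) t - m)); first exact: ltW.
      move=> k kn; have hl := small k l kn lK.
      apply: (le_trans (ler_normB _ _)).
      move: H7; rewrite ler_pdivrMr// -/b2 => hm.
      have : dls * n%:R `^ al <= dl2 / 2 * n%:R `^ b2.
        by apply: ler_pM; rewrite ?powR_ge0 ?(ltW dls0).
      lra.
    have := H3 n n3 l l' lK l'K ll' => /=.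
    rewrite (trunc_sum_id (v := fun k => Num.min ((X (k, l) t - m) ^+ 2) 1 - w)).
      rewrite /= (sum_subr n (fun k => Num.min ((X (k, l) t - m) ^+ 2) 1)).
      rewrite powRr1// ltr_norml => /andP[h _].
      apply: (@le_trans _ _ (\sum_(k < n) Num.min ((X (k : nat, l) t - m) ^+ 2) 1)).
        by move: h; move: (\sum_(k < n) _) => S; lra.
      by apply: ler_sum => k _; rewrite ge_min lexx.
    by move=> k kn; apply: le_trans (h3le _) _; rewrite mulrC -ler_pdivrMr.
  move=> l; rewrite !inE => /orP[/eqP->|/eqP->].
    exact: (main i j).
  by apply: (main j i) => //; rewrite eq_sym.
Qed.

End largest_entry.

Unset Implicit Arguments. Set Strict Implicit. Set Printing Implicit Defensive.

Theorem theorem2p2 (d : measure_display) (T : measurableType d) (R : realType)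
  (P : probability T R) (X : nat * nat -> {RV P >-> R})
  (p : nat -> nat) (alpha : R) :
  mutually_independent X ->
  identically_distributed X ->
  (forall n, (0 < n)%N -> (0 < p n)%N) ->
  (exists c C : R, 0 < c /\ 0 < C /\
     forall n, (0 < n)%N -> c <= n%:R / (p n)%:R <= C) ->
  1 / 2 < alpha <= 1 ->
  nondegenerate_rv (X (0%N, 0%N)) ->
  (\sum_(1 <= n <oo)
     P [set t | (n%:R `^ alpha <= max_prod_row (fun k i => X (k, i) t) n)%R]
     < +oo)%E ->
  {ae P, forall t,
    (fun n : nat => n%:R `^ (1 - alpha) *
       Lmax (fun k i => X (k, i) t) n (p n)) @ \oo --> 0%R}.
Proof.
move=> indepX identX p0 [c [C [c0 [_ cp]]]] /andP[al12 al1] ndX sumX.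
have inv_bound (x : R) : 0 < x -> exists N, N%:R^-1 <= x /\ (0 < N)%N.
  move=> x0; have xV0 : 0 < x^-1 by rewrite invr_gt0.
  have hN : x^-1 < (Num.bound x^-1)%:R by apply: archi_boundP; exact: ltW.
  have N0 : 0 < (Num.bound x^-1)%:R :> R by exact: lt_trans hN.
  exists (Num.bound x^-1); split; last by rewrite -(@ltr0n R).
  by rewrite -[leRHS]invrK lef_pV2 ?posrE// ltW.
(* From [1 / K <= c <= n / p n] follows [p n <= K n]. *)
have [K [Kc K0]] := inv_bound c c0.
have pK n : (0 < n)%N -> (p n <= K * n)%N.
  move=> n0; have /andP[+ _] := cp n n0; have pn0 := p0 n n0.
  rewrite ler_pdivlMr ?ltr0n// => h; rewrite -(ler_nat R) natrM.
  rewrite -ler_pdivrMl ?ltr0n//; apply: le_trans h.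
  by rewrite ler_wpM2r.
have sumX' : (\sum_(n <oo) P (prod_exceeds X (pair 0%N) n (n%:R `^ alpha)) < +oo)%E.
  (* The given series starts at 1; the added term [n = 0] is the probability of an empty event,
     there being no column. *)
  rewrite (nneseries_split 0 1)//= add0n big_nat1.
  have -> : prod_exceeds X (pair 0%N) 0 (0%:R `^ alpha) = set0.
    by apply/seteqP; split => // t [i [j [_]]].
  rewrite measure0 add0e; move: sumX; congr (_ < _)%E.
  apply/congr_lim/funext => N; apply: eq_big_nat => n /andP[n0 _].
  by rewrite prod_exceeds_max_prod_row// powR_gt0// ltr0n.
have [w w0 hw] := normalized_Lmax_small indepX identX ndX al12 al1 pK sumX'.
(* With [e = w / (4 (m + 1))] the bound [4 e / w] equals [1 / (m + 1)]; countably many values of [e]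
   allow a common null set. *)
have e0 (m : nat) : 0 < w / 4 / m.+1%:R by rewrite !divr_gt0.
have ew (m : nat) : w / 4 / m.+1%:R <= w / 4.
  by rewrite ler_pdivrMr// ler_peMr ?divr_ge0 ?(ltW w0)// ler1n.
have := ae_foralln (fun m => hw _ (e0 m) (ew m)).
apply: filterS => t ht; apply/cvgrPdist_le => eps eps0.
have [m [meps m0]] := inv_bound eps eps0.
have [N hN] := ht m.-1; exists N => // n /= Nn.
have /andP[L0 Lm] := hN n Nn.
rewrite sub0r normrN ger0_norm//; apply: (le_trans Lm).
apply: le_trans meps; rewrite prednK// le_eqVlt; apply/orP; left; apply/eqP.
by field; rewrite pnatr_eq0 -lt0n m0 gt_eqF.
Qed.
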